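(* Let $\gamma\subset\mathbb{R}^d$ be a simple $C^{1,1}$-curve. Then there exists $r_0>0$ such that for every $0<r<r_0$ the curve $\gamma$ is an $r$-minimizer for $M=\overline{B_r(\gamma)}$.
   Context: $\mathcal{H}^1$ is the one-dimensional Hausdorff measure. $B_r(T)=\bigcup_{x\in T}B_r(x)$ is the open $r$-neighbourhood of $T\subset\mathbb{R}^d$, where $B_r(x)$ is the open ball. For a compact set $M\subset\mathbb{R}^d$ and $r>0$, an $r$-minimizer for $M$ (maximal distance minimizer) is a connected compact set $\Sigma\subset\mathbb{R}^d$ that has the minimal length $\mathcal{H}^1(\Sigma)$ among all connected compact sets satisfying $\max_{y\in M}\operatorname{dist}(y,\Sigma)\le r$. A rectifiable curve is simple if its arc length parametrization is injective on the closed interval. A curve $\gamma=\gamma(t)$ parametrized by arc length is $C^{1,1}$ if $\gamma'(t)$ is $C$-Lipschitz for some constant $C$. *)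

(* Defs.v *)
From mathcomp Require Import all_boot all_order all_algebra.
From mathcomp Require Import all_classical all_reals all_analysis.
Import Order.TTheory GRing.Theory Num.Theory.
Import numFieldNormedType.Exports.

Set Implicit Arguments.
Unset Strict Implicit.
Unset Printing Implicit Defensive.

Local Open Scope classical_set_scope.
Local Open Scope ring_scope.

(* The norm and [ball] that the library puts on ['rV[R]_d] are those of the
   maximum norm, so every metric notion below goes through [enorm]. Its
   topology is the product one, hence [compact], [connected], [closure] and
   limits are the usual ones of the Euclidean space R^d. *)
Definition enorm (R : realType) (d : nat) (x : 'rV[R]_d) : R :=
  Num.sqrt (\sum_(i < d) x 0 i ^+ 2).

Definition eball (R : realType) (d : nat) (x : 'rV[R]_d) (r : R) :
    set 'rV[R]_d :=
  [set y | enorm (y - x) < r].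

Definition open_nbhd (R : realType) (d : nat) (r : R) (T : set 'rV[R]_d) :
    set 'rV[R]_d :=
  \bigcup_(x in T) eball x r.

(* [ereal_inf set0 = +oo]: no point is at finite distance from the empty set. *)
Definition edist_set (R : realType) (d : nat) (y : 'rV[R]_d)
    (S : set 'rV[R]_d) : \bar R :=
  ereal_inf [set (enorm (y - x))%:E | x in S].

(* The supremum is the maximum when [M] and [S] are compact and nonempty. *)
Definition max_dist (R : realType) (d : nat) (M S : set 'rV[R]_d) : \bar R :=
  ereal_sup [set edist_set y S | y in M].

(* [ereal_sup set0 = -oo], so the [maxe] is what gives [set0] diameter 0. *)
Definition ediam (R : realType) (d : nat) (A : set 'rV[R]_d) : \bar R :=
  maxe 0%E (ereal_sup [set (enorm (z.1 - z.2))%:E | z in A `*` A]).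

Definition hausdorff1_pre (R : realType) (d : nat) (delta : R)
    (A : set 'rV[R]_d) : \bar R :=
  ereal_inf [set (\sum_(0 <= i <oo) ediam (U i))%E | U in
    [set U : nat -> set 'rV[R]_d |
      A `<=` \bigcup_i U i /\ forall i, (ediam (U i) <= delta%:E)%E]].

Definition hausdorff1 (R : realType) (d : nat) (A : set 'rV[R]_d) : \bar R :=
  ereal_sup [set hausdorff1_pre delta A | delta in [set delta : R | 0 < delta]].

Definition competitor (R : realType) (d : nat) (r : R)
    (M S : set 'rV[R]_d) : Prop :=
  [/\ connected S, compact S & (max_dist M S <= r%:E)%E].

Definition r_minimizer (R : realType) (d : nat) (r : R)
    (M Sigma : set 'rV[R]_d) : Prop :=
  competitor r M Sigma /\
  forall S : set 'rV[R]_d, competitor r M S ->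
    (hausdorff1 Sigma <= hausdorff1 S)%E.

(* Length of the inscribed polygon with vertices [g a] and the [g x], for [x]
   in [s]; the vector-valued analogue of the library's [variation]. *)
Definition polygon_length (R : realType) (d : nat) (a b : R)
    (g : R -> 'rV[R]_d) (s : seq R) : R :=
  let F := nth b (a :: s) in
  \sum_(0 <= n < size s) enorm (g (F n.+1) - g (F n)).

Definition curve_length (R : realType) (d : nat) (a b : R)
    (g : R -> 'rV[R]_d) : \bar R :=
  ereal_sup [set (polygon_length a b g s)%:E | s in itv_partition a b].

(* Only the values of [g] on [0, L] matter. *)
Definition arc_length_param (R : realType) (d : nat) (L : R)
    (g : R -> 'rV[R]_d) : Prop :=
  {within `[0, L], continuous g} /\
  forall s t : R, 0 <= s -> s <= t -> t <= L ->
    curve_length s t g = (t - s)%:E.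

(* [g'] is the derivative of [g] on [0, L], one-sided at 0 and at L. *)
Definition derivative_on (R : realType) (d : nat) (L : R)
    (g g' : R -> 'rV[R]_d) : Prop :=
  forall t : R, t \in `[0, L] ->
    (s - t)^-1 *: (g s - g t) @[s --> within `[0, L] t^'] --> g' t.

Definition C11_on (R : realType) (d : nat) (L : R) (g : R -> 'rV[R]_d) : Prop :=
  exists g' : R -> 'rV[R]_d, derivative_on L g g' /\
  exists C : R, {in `[0, L] &, forall s t : R,
    enorm (g' s - g' t) <= C * `|s - t|}.

Definition simple_C11_curve (R : realType) (d : nat)
    (Gamma : set 'rV[R]_d) : Prop :=
  exists (L : R) (g : R -> 'rV[R]_d),
    [/\ 0 < L, arc_length_param L g, {in `[0, L] &, injective g},
        C11_on L g & Gamma = g @` `[0, L]].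

(* Main.v *)
Require Import Defs.
From mathcomp Require Import all_boot all_order all_algebra.
From mathcomp Require Import all_classical all_reals all_analysis.
From mathcomp Require Import ring lra.
Import Order.TTheory GRing.Theory Num.Theory.
Import numFieldNormedType.Exports.

(** The curve is minimal because its tubes have the largest volume that their
    length allows.

    Sliding a ball of radius [s] by a small distance [t] sweeps about [c * t] of
    new volume, with [c] depending on [s] only. Along the curve, when [s] is
    small, the balls centred on the curve that contain a given point have
    consecutive centres ([ball_interval]): near-by centres because the squared
    distance to the point is convex along a short arc, distant ones because a
    simple curve keeps them apart. So a ball sliding along the curve never sweeps
    the same volume twice ([chain_content]), and the tube has volume
    [V + c * L], where [V] is the volume of the ball. A competitor of length
    less than [H] is approximated by a finite tree of length at most [H]
    ([exists_tree]), and attaching the vertices one by one shows that its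
    neighbourhood of radius [s] has volume at most [V + c * H]
    ([tree_content]). Since that neighbourhood contains the tube
    ([competitor_near]), [L <= H].

    The only properties of the volume used here are monotonicity, subadditivity,
    additivity for sets at positive distance, and invariance under isometries.
    A content with these properties is obtained as a limit, along an ultrafilter,
    of normalised numbers of Euclidean balls of small radius needed to cover a
    set ([exists_content]); invariance is then immediate. Two features of
    Lebesgue measure have to be replaced. Additivity of the content across the
    boundary of a ball holds for all radii but countably many
    ([content_split], [exists_regular_radius]). The cost [c] of a radius is not
    known to depend continuously on the radius, whereas the approximating tree
    needs a slightly larger radius than the curve; the comparison
    ([tube_comparison]) is therefore summed over a long increasing sequence of
    radii in [r, r0[, along which the volumes of balls telescope and the costs
    stay between two positive bounds ([competitor_length]). *)

Set Implicit Arguments.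
Unset Strict Implicit.
Unset Printing Implicit Defensive.

Local Open Scope classical_set_scope.
Local Open Scope ring_scope.

(** * Euclidean geometry of row vectors *)

Section Euclid.
Context {R : realType} {d : nat}.
Implicit Types (x y z u v w e : 'rV[R]_d) (a b r s t : R).

Definition dotv x y : R := \sum_(i < d) x 0 i * y 0 i.

Lemma dotvC x y : dotv x y = dotv y x.
Proof. by apply: eq_bigr => i _; rewrite mulrC. Qed.

Lemma dotvDl x y z : dotv (x + y) z = dotv x z + dotv y z.
Proof. by rewrite /dotv -big_split; apply: eq_bigr => i _; rewrite !mxE mulrDl. Qed.

Lemma dotvZl a x y : dotv (a *: x) y = a * dotv x y.
Proof. by rewrite /dotv mulr_sumr; apply: eq_bigr => i _; rewrite !mxE mulrA. Qed.

Lemma dotvNl x y : dotv (- x) y = - dotv x y.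
Proof. by rewrite -scaleN1r dotvZl mulN1r. Qed.

Lemma dotvDr x y z : dotv z (x + y) = dotv z x + dotv z y.
Proof. by rewrite dotvC dotvDl !(dotvC z). Qed.

Lemma dotvZr a x y : dotv y (a *: x) = a * dotv y x.
Proof. by rewrite dotvC dotvZl dotvC. Qed.

Lemma dotvNr x y : dotv y (- x) = - dotv y x.
Proof. by rewrite dotvC dotvNl dotvC. Qed.

Definition dotvE := (dotvDl, dotvDr, dotvNl, dotvNr, dotvZl, dotvZr).

Lemma dotv_ge0 x : 0 <= dotv x x.
Proof. by apply: sumr_ge0 => i _; rewrite -expr2 sqr_ge0. Qed.

Lemma dotv_eq0 x : dotv x x = 0 -> x = 0.
Proof.
move=> /eqP; rewrite psumr_eq0 => [|i _]; last by rewrite -expr2 sqr_ge0.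
move=> /allP h; apply/rowP => i; rewrite mxE; apply/eqP.
by have := h i (mem_index_enum _); rewrite /= mulf_eq0 orbb.
Qed.

Lemma enormE x : enorm x = Num.sqrt (dotv x x).
Proof. by congr Num.sqrt; apply: eq_bigr => i _; rewrite expr2. Qed.

Lemma enorm_ge0 x : 0 <= enorm x.
Proof. exact: sqrtr_ge0. Qed.

Lemma enorm_sqr x : enorm x ^+ 2 = dotv x x.
Proof. by rewrite enormE sqr_sqrtr ?dotv_ge0. Qed.

Lemma enorm_eq0 x : enorm x = 0 -> x = 0.
Proof. by move=> h; apply: dotv_eq0; rewrite -enorm_sqr h expr0n. Qed.

Lemma enorm0 : enorm (0 : 'rV[R]_d) = 0.
Proof.
rewrite enormE -(scale0r (0 : 'rV[R]_d)) dotvZl mul0r; exact: sqrtr0.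
Qed.

Lemma enormZ a x : enorm (a *: x) = `|a| * enorm x.
Proof. by rewrite !enormE !dotvE mulrA -expr2 sqrtrM ?sqr_ge0// sqrtr_sqr. Qed.

Lemma enormN x : enorm (- x) = enorm x.
Proof. by rewrite !enormE !dotvE opprK. Qed.

Lemma enormC x y : enorm (x - y) = enorm (y - x).
Proof. by rewrite -enormN opprB. Qed.

(** Cauchy-Schwarz. *)
Lemma dotv_le x y : dotv x y <= enorm x * enorm y.
Proof.
have [y0|y0] := eqVneq (enorm y) 0.
  by rewrite (enorm_eq0 y0) enorm0 mulr0 -(scale0r (0 : 'rV[R]_d)) dotvZr mul0r.
have yp : 0 < enorm y by rewrite lt_def y0 enorm_ge0.
have := dotv_ge0 (enorm y *: x - enorm x *: y).
rewrite !dotvE -!enorm_sqr (dotvC y x) => h.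
have [x0|x0] := eqVneq (enorm x) 0.
  by rewrite (enorm_eq0 x0) enorm0 mul0r -(scale0r (0 : 'rV[R]_d)) dotvZl mul0r.
have xp : 0 < enorm x by rewrite lt_def x0 enorm_ge0.
rewrite -(ler_pM2l (mulr_gt0 xp yp)).
move: h; set p := enorm x; set q := enorm y; set D := dotv x y.
by move=> h; nra.
Qed.

Lemma enormD x y : enorm (x + y) <= enorm x + enorm y.
Proof.
rewrite -(ler_pXn2r (n := 2)) ?nnegrE ?addr_ge0 ?enorm_ge0//.
rewrite enorm_sqr !dotvE -!enorm_sqr (dotvC y x).
by have := dotv_le x y; lra.
Qed.

Lemma enormB y x z : enorm (x - z) <= enorm (x - y) + enorm (y - z).
Proof. by rewrite -[x - z](subrKA y) enormD. Qed.

Lemma enorm_coord x i : `|x 0 i| <= enorm x.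
Proof.
rewrite -(ler_pXn2r (n := 2)) ?nnegrE ?enorm_ge0//.
rewrite enorm_sqr real_normK ?num_real// expr2 /dotv (bigD1 i)//= lerDl.
by apply: sumr_ge0 => j _; rewrite -expr2 sqr_ge0.
Qed.

Lemma continuous_enorm : continuous (@enorm R d).
Proof.
move=> x; apply: (@continuous_comp _ _ _
  (fun y : 'rV[R]_d => \sum_(i < d) y 0 i ^+ 2) Num.sqrt); last first.
  exact: sqrt_continuous.
apply: continuous_big => [|i _ {}x].
  by move=> p; exact: add_continuous.
apply: (@continuous_comp _ _ _ (fun y : 'rV[R]_d => y 0 i) (fun t => t ^+ 2)).
  exact: coord_continuous.
exact: exprn_continuous.
Qed.

Lemma eball_center x r : 0 < r -> eball x r x.
Proof. by rewrite /eball /= subrr enorm0. Qed.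

Lemma open_eball x r : open (eball x r).
Proof.
have cf : continuous (fun y : 'rV[R]_d => enorm (y - x)).
  move=> y; apply: (@continuous_comp _ _ _ (fun y : 'rV[R]_d => y - x) (@enorm R d)).
    exact: (@cvgB R 'rV[R]_d _ (nbhs y) _ id (fun=> x) y x cvg_id (cvg_cst x)).
  exact: continuous_enorm.
apply: (@open_comp _ _ (fun y : 'rV[R]_d => enorm (y - x)) [set t | t < r]).
  by move=> y _; exact: cf.
exact: open_lt.
Qed.

Definition ebounded (A : set 'rV[R]_d) := exists M, A `<=` eball 0 M.

Lemma ebounded_sub A B : A `<=` B -> ebounded B -> ebounded A.
Proof. by move=> AB [M BM]; exists M; apply: subset_trans BM. Qed.

Lemma ebounded_eball x r : ebounded (eball x r).
Proof.
exists (enorm x + r) => y; rewrite /eball /= subr0 => yr.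
by have := enormD (y - x) x; rewrite subrK; lra.
Qed.

Lemma eboundedU A B : ebounded A -> ebounded B -> ebounded (A `|` B).
Proof.
move=> [M AM] [N BN]; exists (Num.max M N) => x [/AM|/BN];
  by rewrite /eball /= lt_max => ->; rewrite ?orbT.
Qed.

(** Heine-Borel turns boundedness into total boundedness. *)
Lemma ebounded_totally A eps : 0 < eps -> ebounded A ->
  exists s : seq 'rV[R]_d, A `<=` \bigcup_(c in [set` s]) eball c eps.
Proof.
move=> e0 [M AM].
have cK : compact [set x : 'rV[R]_d | enorm x <= M].
  apply: bounded_closed_compact; last first.
    have -> : [set x : 'rV[R]_d | enorm x <= M]
      = (@enorm R d) @^-1` [set t | t <= M] by [].
    apply: preimage_closed; last exact: closed_le.
    by move=> x _; exact: continuous_enorm.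
  exists M; split; first exact: num_real.
  move=> B MB x /= xM; rewrite [leLHS]/Num.norm /= mx_normrE; apply/bigmax_leP; split.
    by apply: le_trans (ltW MB); apply: le_trans xM; exact: enorm_ge0.
  move=> [i j] _ /=; rewrite (ord1 i); apply: le_trans (ltW MB).
  by apply: le_trans xM; exact: enorm_coord.
move: cK; rewrite compact_cover => /(_ 'rV[R]_d setT (fun c => eball c eps)).
case=> [c _|x _|D _ cov]; first exact: open_eball.
  by exists x => //; exact: eball_center.
exists (finmap.enum_fset D) => x /AM xM; case: (cov x).
  by move: xM; rewrite /eball /= subr0 => /ltW.
by move=> c cD xc; exists c.
Qed.

End Euclid.

(** * An isometry-invariant content *)

Section Content.
Context {R : realType} {d : nat}.
Implicit Types (A B : set 'rV[R]_d) (x y z c : 'rV[R]_d) (r t eps : R).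
Implicit Types (s : seq 'rV[R]_d) (m : set 'rV[R]_d -> R).

Definition euclid_isometry (T : 'rV[R]_d -> 'rV[R]_d) :=
  forall x y, enorm (T x - T y) = enorm (x - y).

Definition covers eps s A := A `<=` \bigcup_(c in [set` s]) eball c eps.

Definition ncov eps A : nat :=
  if pselect (exists n, `[< exists2 s, size s = n & covers eps s A >])
    is left e then ex_minn e else 0%N.

Lemma ncov_min eps s A : covers eps s A -> (ncov eps A <= size s)%N.
Proof.
move=> sA; rewrite /ncov; case: pselect => // e; case: ex_minnP => n _.
by apply; apply/asboolP; exists s.
Qed.

Lemma ncov_attained eps A : 0 < eps -> ebounded A ->
  exists2 s, size s = ncov eps A & covers eps s A.
Proof.
move=> e0 bA; have [s sA] := ebounded_totally e0 bA.
rewrite /ncov; case: pselect => [e|[]]; last first.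
  by exists (size s); apply/asboolP; exists s.
by case: ex_minnP => n /asboolP[s' <- ?] _; exists s'.
Qed.

Lemma ncov_le eps A B : 0 < eps -> A `<=` B -> ebounded B ->
  (ncov eps A <= ncov eps B)%N.
Proof.
move=> e0 AB bB; have [s <- sB] := ncov_attained e0 bB.
by apply: ncov_min; exact: subset_trans sB.
Qed.

Lemma ncovU eps A B : 0 < eps -> ebounded A -> ebounded B ->
  (ncov eps (A `|` B) <= ncov eps A + ncov eps B)%N.
Proof.
move=> e0 bA bB; have [s <- sA] := ncov_attained e0 bA.
have [t <- tB] := ncov_attained e0 bB.
rewrite -size_cat; apply: ncov_min => x [/sA|/tB] [c /= cs xc]; exists c => //=;
  by rewrite mem_cat cs ?orbT.
Qed.

Lemma ncov_sep eps A B : 0 < eps -> ebounded A -> ebounded B ->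
  (forall a b, A a -> B b -> 2 * eps <= enorm (a - b)) ->
  (ncov eps A + ncov eps B <= ncov eps (A `|` B))%N.
Proof.
move=> e0 bA bB sep; have [s <- sAB] := ncov_attained e0 (eboundedU bA bB).
pose p (D : set 'rV[R]_d) c := `[< exists2 a, D a & eball c eps a >].
have cov D : D `<=` A `|` B -> (ncov eps D <= count (p D) s)%N.
  move=> DAB; rewrite -size_filter; apply: ncov_min => x Dx.
  have [c /= cs xc] := sAB _ (DAB _ Dx); exists c => //=.
  by rewrite mem_filter cs andbT; apply/asboolP; exists x.
rewrite -(count_predC (p A) s); apply: leq_add; first by apply: cov => x; left.
apply: (leq_trans (cov B _)) => [x|]; first by right.
apply: sub_count => c /asboolP[b Bb bc]; apply/negP => /asboolP[a Aa ac].
have := sep a b Aa Bb; have := enormB c a b.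
by move: ac bc; rewrite /eball /= (enormC b); lra.
Qed.

Lemma ncov_isometry eps T A B : 0 < eps -> ebounded B -> euclid_isometry T ->
  A `<=` T @` B -> (ncov eps A <= ncov eps B)%N.
Proof.
move=> e0 bB iT AB; have [s <- sB] := ncov_attained e0 bB.
rewrite -(size_map T); apply: ncov_min => _ /AB[x /sB[c /= cs xc] <-].
by exists (T c); [exact: map_f|rewrite /eball /= iT].
Qed.

Lemma ncov_gt0 eps A : 0 < eps -> ebounded A -> A !=set0 ->
  (0 < ncov eps A)%N.
Proof.
move=> e0 bA [x Ax]; have [s <- sA] := ncov_attained e0 bA.
by have [c /= cs _] := sA x Ax; case: s cs {sA}.
Qed.

(** This ratio bound, uniform in the mesh, is what keeps the normalised
    covering numbers of a bounded set in a compact interval. *)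
Lemma ncov_ratio r A : 0 < r -> ebounded A -> exists K : nat,
  forall eps, 0 < eps -> (ncov eps A <= K * ncov eps (eball 0%R r))%N.
Proof.
move=> r0 bA; have [s sA] := ebounded_totally r0 bA.
exists (size s) => eps e0.
have [t <- tB] := ncov_attained e0 (ebounded_eball (0 : 'rV[R]_d) r).
rewrite -(size_allpairs +%R); apply: ncov_min => y /sA[c /= cs yc].
have [|x /= xt yx] := tB (y - c); first by rewrite /eball /= subr0.
exists (c + x); first by apply/allpairsP; exists (c, x).
by rewrite /eball /= opprD addrA.
Qed.

(** What the volume argument needs of Lebesgue measure, as a finitely additive
    content; additivity is only asked at positive distance. *)
Record is_content r m : Prop := IsContent {
  content_le : forall A B, A `<=` B -> ebounded B -> m A <= m B;
  contentU : forall A B, ebounded A -> ebounded B ->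
    m (A `|` B) <= m A + m B;
  content_sep : forall A B t, ebounded A -> ebounded B -> 0 < t ->
    (forall a b, A a -> B b -> t <= enorm (a - b)) ->
    m A + m B <= m (A `|` B);
  content_isometry : forall T A B, euclid_isometry T -> ebounded B ->
    A `<=` T @` B -> m A <= m B;
  content_unit : m (eball 0 r) = 1 }.

(** Haar's construction of an invariant measure, with Euclidean balls as
    gauges: covering numbers are invariant under all isometries, and a limit
    along an ultrafilter keeps the (in)equalities between their quotients. *)
Lemma exists_content r : 0 < r -> exists m, is_content r m.
Proof.
move=> r0; have [U [UU ooU]] := ultraFilterLemma (@eventually_filter : ProperFilter \oo).
pose e (n : nat) : R := n.+1%:R^-1.
have e0 n : 0 < e n by rewrite invr_gt0.
pose N n : R := (ncov (e n) (eball 0 r))%:R.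
have N0 n : 0 < N n.
  rewrite ltr0n ncov_gt0//; first exact: ebounded_eball.
  by exists 0; exact: eball_center.
pose u A n : R := (ncov (e n) A)%:R / N n.
have PU : ProperFilter U by exact: ultra_proper.
have cu A : ebounded A -> exists l : R, u A n @[n --> U] --> l.
  move=> bA; have [K uK] := ncov_ratio r0 bA.
  have [|l [_ ul]] := @segment_compact R 0 K%:R (u A @ U) _.
    rewrite /nbhs /=; apply: filterE => n.
    rewrite /= in_itv /= /u divr_ge0 ?ler0n ?(ltW (N0 n))//= ler_pdivrMr//.
    by rewrite -natrM ler_nat uK.
  exists l => V lV; have [//|UV] := in_ultra_setVsetC (u A @^-1` V) UU.
  by have [? []] := ul (~` V) V UV lV.
pose m A := lim (u A n @[n --> U]).
have um A : ebounded A -> u A n @[n --> U] --> m A.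
  by move=> /cu[l ul]; apply/cvg_ex; exists l.
have uD A B n : (u A + u B) n = (ncov (e n) A + ncov (e n) B)%:R / N n.
  by rewrite natrD mulrDl.
have le A B (a b : R) : (u A @ U --> a) -> (u B @ U --> b) ->
    (\forall n \near U, u A n <= u B n) -> a <= b.
  by move=> ua ub ab; exact: (ler_cvg_to ua ub).
exists m; split.
- move=> A B AB bB; apply: (le _ _ _ _ (um A _) (um B bB)).
    exact: ebounded_sub bB.
  apply: filterE => n; rewrite ler_pM2r ?invr_gt0//.
  by rewrite ler_nat ncov_le.
- move=> A B bA bB; apply: (ler_cvg_to (um _ (eboundedU bA bB))).
    exact: (cvgD (um A bA) (um B bB)).
  apply: filterE => n /=; rewrite uD ler_pM2r ?invr_gt0//.
  by rewrite ler_nat ncovU.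
- move=> A B t bA bB t0 sep.
  apply: (ler_cvg_to (cvgD (um A bA) (um B bB)) (um _ (eboundedU bA bB))).
  have : \forall n \near \oo, e n <= t / 2.
    have := @near_infty_natSinv_lt R (PosNum (divr_gt0 t0 (ltr0n R 2))).
    by apply: filterS => n /= /ltW.
  move=> /ooU; apply: filterS => n et.
  rewrite /= uD ler_pM2r ?invr_gt0//.
  rewrite ler_nat ncov_sep// => a b Aa Bb.
  by have := sep a b Aa Bb; lra.
- move=> T A B iT bB AB; apply: (le _ _ _ _ (um A _) (um B bB)).
    have [M BM] := bB; exists (enorm (T 0) + M) => _ /AB[x /BM xM <-].
    have := enormB (T 0) (T x) 0; move: xM.
    by rewrite /eball /= iT !subr0; lra.
  apply: filterE => n; rewrite ler_pM2r ?invr_gt0//.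
  by rewrite ler_nat (ncov_isometry _ _ iT).
- have u1 : u (eball 0 r) @ U --> (1 : R).
    have -> : u (eball 0 r) = cst 1.
      by apply/funext => n; apply: divff; exact: lt0r_neq0 (N0 n).
    exact: cvg_cst.
  exact: (cvg_unique _ (um _ (ebounded_eball 0 r)) u1).
Qed.

End Content.

(** * Isometries and the content of balls *)

Section Isometries.
Context {R : realType} {d : nat}.
Implicit Types (u v w x y z : 'rV[R]_d).

(** For [v = w] the coefficient is a quotient by 0, hence 0, and the map is the
    identity. *)
Definition reflection v w z :=
  z - (2 * dotv z (v - w) / dotv (v - w) (v - w)) *: (v - w).

Lemma reflectionB v w x y :
  reflection v w (x - y) = reflection v w x - reflection v w y.
Proof.
rewrite /reflection; set u := v - w.
rewrite dotvDl dotvNl mulrBr mulrBl scalerBl.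
by rewrite !opprD !opprK addrACA.
Qed.

Lemma reflection_isometry v w : euclid_isometry (reflection v w).
Proof.
move=> x y; rewrite -reflectionB; move: (x - y) => z.
rewrite !enormE; congr Num.sqrt; rewrite /reflection; move: (v - w) => u.
have [->|u0] := eqVneq u 0; first by rewrite scaler0 subr0.
have q0 : dotv u u != 0 by apply: contra_neq u0; exact: dotv_eq0.
by rewrite !dotvE (dotvC u z); field.
Qed.

Lemma reflectionK v w : involutive (reflection v w).
Proof.
move=> z; rewrite /reflection; move: (v - w) => u.
have [->|u0] := eqVneq u 0; first by rewrite !scaler0 !subr0.
have q0 : dotv u u != 0 by apply: contra_neq u0; exact: dotv_eq0.
rewrite -addrA -opprD -scalerDl !dotvE.
set k := (X in X *: _); suff -> : k = 0 by rewrite scale0r subr0.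
by rewrite /k; field.
Qed.

Lemma reflection_swap v w : enorm v = enorm w -> reflection v w v = w.
Proof.
move=> vw; rewrite /reflection; set u := v - w.
have [u0|u0] := eqVneq u 0.
  by rewrite u0 scaler0 subr0; apply/eqP; rewrite -subr_eq0 -/u u0.
have q0 : dotv u u != 0 by apply: contra_neq u0; exact: dotv_eq0.
suff -> : 2 * dotv v u = dotv u u.
  by rewrite divff// scale1r opprB addrC subrK.
by rewrite !dotvE (dotvC w v) -!enorm_sqr vw; ring.
Qed.

(** Euclidean isometries act transitively on pairs of points at a given
    distance: a translation followed by a reflection is enough. *)
Lemma isometry_pair x y x' y' : enorm (x - y) = enorm (x' - y') ->
  exists T, [/\ euclid_isometry T, T x' = x, T y' = y & forall z, exists z', T z' = z].
Proof.
move=> xy; exists (fun z => reflection (x' - y') (x - y) (z - y') + y).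
have addK (p q r : 'rV[R]_d) : p + r - (q + r) = p - q.
  by rewrite opprD addrACA subrr addr0.
have z0 v w : reflection v w 0 = 0.
  by have := reflectionB v w 0 0; rewrite !subrr.
split.
- move=> z z'; rewrite addK -reflectionB addK.
  have := reflection_isometry (x' - y') (x - y) (z - z') 0.
  by rewrite z0 !subr0.
- rewrite reflection_swap; first by rewrite subrK.
  by rewrite xy.
- by rewrite subrr z0 add0r.
- move=> z; exists (reflection (x' - y') (x - y) (z - y) + y').
  by rewrite addrK reflectionK subrK.
Qed.

End Isometries.

Section BallContent.
Context {R : realType} {d : nat} (a : R) (m : set 'rV[R]_d -> R).
Hypothesis mP : is_content a m.
Implicit Types (A B : set 'rV[R]_d) (x y z e : 'rV[R]_d) (r s t : R).

Let bB x r := ebounded_eball x r.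

Definition ball_content r := m (eball 0 r).
Local Notation F := ball_content.

Lemma content_ge0 A : ebounded A -> 0 <= m A.
Proof.
move=> bA; have b0 : ebounded (set0 : set 'rV[R]_d) by exists 0.
apply: le_trans (content_le mP (@sub0set _ A) bA).
by have := contentU mP b0 b0; rewrite setU0; lra.
Qed.

Lemma content_ball x r : m (eball x r) = F r.
Proof.
have iT c : euclid_isometry (fun z : 'rV[R]_d => z + c).
  by move=> y z; rewrite opprD addrACA subrr addr0.
apply/eqP; rewrite eq_le; apply/andP; split.
  apply: (content_isometry mP (iT x)) => // y yr.
  by exists (y - x); rewrite ?subrK// /eball /= subr0.
apply: (content_isometry mP (iT (- x))) => // y yr; exists (y + x).
  by rewrite /eball /= addrK; move: yr; rewrite /eball /= subr0.
by rewrite addrK.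
Qed.

Lemma ball_content_le r s : r <= s -> F r <= F s.
Proof.
move=> rs; apply: (content_le mP) => // y; rewrite /eball /=.
by move=> /lt_le_trans; apply.
Qed.

Lemma ball_content_ge1 r : a <= r -> 1 <= F r.
Proof. by move=> ar; rewrite -(content_unit mP); exact: ball_content_le. Qed.

(** Balls of such a radius have negligible boundary, and so split every bounded
    set additively; being a condition on a monotone function, it only excludes
    countably many radii. *)
Definition regular_radius r :=
  forall eps, 0 < eps -> exists2 t, 0 < t & F r - F (r - t) < eps.

(** The shell and the smaller ball [eball x (r - 2 * t)] are at distance [t], and
    both lie in [eball x r]. *)
Lemma shell_content x r t : 0 < t ->
  m (eball x r `\` eball x (r - t)) <= F r - F (r - 2 * t).
Proof.
move=> t0; rewrite lerBrDr -(content_ball x (r - _)) -(content_ball x r).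
have bS : ebounded (eball x r `\` eball x (r - t)).
  by apply: ebounded_sub (bB x r); exact: subDsetl.
apply: le_trans (content_sep mP bS (bB _ _) t0 _) _; last first.
  apply: (content_le mP) => // y [[]//|]; rewrite /eball /=; lra.
move=> y z [_ /negP]; rewrite -leNgt => ry rz.
by have := enormB z y x; move: rz; rewrite /eball /=; lra.
Qed.

(** The part of [A] inside a slightly smaller ball is at positive distance from
    the part outside [eball x r]; what is lost lies in a thin shell, of small
    content since [r] is regular. *)
Lemma content_split x r A : regular_radius r -> ebounded A ->
  m (A `&` eball x r) + m (A `\` eball x r) <= m A.
Proof.
move=> rr bA; apply/ler_addgt0Pr => eps eps0.
have [t t0 tF] := rr eps eps0; set h := t / 2; have h0 : 0 < h by rewrite divr_gt0.
have bD : ebounded (A `\` eball x r) by apply: ebounded_sub bA; exact: subDsetl.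
have bI s : ebounded (A `&` eball x s).
  by apply: ebounded_sub bA; exact: subIsetl.
have bS : ebounded (eball x r `\` eball x (r - h)).
  by apply: ebounded_sub (bB x r); exact: subDsetl.
have h1 : m (A `&` eball x r) <=
    m (A `&` eball x (r - h)) + m (eball x r `\` eball x (r - h)).
  apply: le_trans (contentU mP (bI _) bS).
  apply: (content_le mP); last exact: eboundedU.
  move=> y [Ay yr]; have [yh|yh] := pselect (eball x (r - h) y); [left|right];
    by split.
have h2 := shell_content x r h0.
have h3 : m (A `&` eball x (r - h)) + m (A `\` eball x r) <= m A.
  apply: le_trans (content_sep mP (bI _) bD h0 _) _; last first.
    by apply: (content_le mP) => // y [[]|[]].
  move=> y z [_ yr] [_ /negP]; rewrite -leNgt => zr.
  by have := enormB y z x; move: yr; rewrite /eball /= (enormC z y); lra.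
move: h2; rewrite (_ : 2 * h = t); last by rewrite /h; field.
by lra.
Qed.

Lemma exists_regular_radius r s : r < s ->
  exists2 t, r < t < s & regular_radius t.
Proof.
move=> rs.
have ndF (i : interval R) : {in i &, nondecreasing_fun F}.
  by move=> x y _ _; exact: ball_content_le.
have cD := discontinuity_countable (ndF `[r, s]%R).
have [t [trs tD]] : exists t, t \in `]r, s[%R /\ ~ discontinuity F t.
  apply: contrapT => h; have : countable [set` `]r, s[%R].
    apply: sub_countable cD; apply: subset_card_le => t /= trs.
    by split; [rewrite inE|apply: contrapT => nt; apply: h; exists t].
  move=> /countable_lebesgue_measure0; rewrite lebesgue_measure_itv /= lte_fin rs.
  by move=> /eqP; rewrite -EFinB eqe subr_eq0 gt_eqF.
move: trs; rewrite in_itv /= => /andP[rt ts].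
exists t; first by rewrite rt.
have cl : cvg (F x @[x --> t^'-]).
  apply: nondecreasing_at_left_is_cvgr; near=> y; first exact: ndF.
  by exists (F t) => _ [z /= + <-]; rewrite in_itv /= => /andP[_ /ltW /ball_content_le].
have cr : cvg (F x @[x --> t^'+]).
  apply: nondecreasing_at_right_is_cvgr; near=> y; first exact: ndF.
  by exists (F t) => _ [z /= + <-]; rewrite in_itv /= => /andP[/ltW /ball_content_le].
have lr : lim (F x @[x --> t^'-]) = lim (F x @[x --> t^'+]).
  by apply/eqP; apply: contra_notT tD => ?; split.
have lt : F t <= lim (F x @[x --> t^'-]).
  rewrite lr; apply: limr_ge => //; near=> y.
  by apply: ball_content_le; near: y; exact: nbhs_right_ge.
move=> eps eps0; near (t^'-) => y.
have yt : y < t by near: y; exact: nbhs_left_lt.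
exists (t - y); first by rewrite subr_gt0.
rewrite subKr.
apply: le_lt_trans (_ : `|lim (F x @[x --> t^'-]) - F y| < eps).
  by apply: le_trans (ler_norm _); rewrite lerB.
by near: y; exact: cvgr_dist_lt.
Unshelve. all: by end_near. Qed.

End BallContent.

(** * The content added by moving a ball *)

Section Tree.
Context {R : realType} {d : nat}.
Implicit Types (x p : 'rV[R]_d).

(** Finite trees, each new vertex being attached to an old one; the real number
    is the total length of the edges. *)
Inductive tree : seq 'rV[R]_d -> R -> Prop :=
| tree_root x : tree [:: x] 0
| tree_leaf (q : seq 'rV[R]_d) (l : R) x p : p \in q -> tree q l ->
    tree (x :: q) (l + enorm (x - p)).

Lemma ebounded_balls (q : seq 'rV[R]_d) r :
  ebounded (\bigcup_(x in [set` q]) eball x r).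
Proof.
elim: q => [|x q ih]; first by exists 0 => z [].
apply: ebounded_sub (eboundedU (ebounded_eball x r) ih).
move=> z [y /=]; rewrite inE => /predU1P[->|yq] zy; first by left.
by right; exists y.
Qed.

End Tree.

Section Displacement.
Context {R : realType} {d : nat} (a : R) (m : set 'rV[R]_d -> R).
Hypothesis mP : is_content a m.
Variable e : 'rV[R]_d.
Hypothesis e1 : enorm e = 1.
Implicit Types (A B : set 'rV[R]_d) (x y z : 'rV[R]_d) (r s t : R).

Let bB x r := ebounded_eball x r.
Local Notation F := (ball_content m).

(** The content gained when a ball of radius [r] moves by a distance [s]. *)
Definition displacement r s := m (eball (s *: e) r `\` eball 0 r).
Local Notation psi := displacement.

Let bD x y r : ebounded (eball x r `\` eball y r).
Proof. by apply: ebounded_sub (bB x r); exact: subDsetl. Qed.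

(** Only the distance of the two centres matters, since the content is invariant
    under isometries. This is why the direction [e] does not appear on the
    left. *)
Lemma displacementE r x y :
  m (eball x r `\` eball y r) = psi r (enorm (x - y)).
Proof.
have le u v u' v' : enorm (u - v) = enorm (u' - v') ->
    m (eball u r `\` eball v r) <= m (eball u' r `\` eball v' r).
  move=> /isometry_pair[T [iT Tu Tv sT]].
  apply: (content_isometry mP iT (bD _ _ _)) => z [zu zv].
  have [z' zE] := sT z; exists z' => //; split.
    by move: zu; rewrite /eball /= -zE -Tu iT.
  by move: zv; rewrite /eball /= -zE -Tv iT.
have h : enorm (enorm (x - y) *: e - 0) = enorm (x - y).
  by rewrite subr0 enormZ e1 mulr1 ger0_norm ?enorm_ge0.
by apply/eqP; rewrite eq_le !le.
Qed.

Lemma displacement_ge0 r s : 0 <= psi r s.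
Proof. exact: (content_ge0 mP (bD _ _ _)). Qed.

(** Removing the moved ball from the fixed one instead, the difference sets
    become nested: a convexity argument along the direction [e]. *)
Lemma displacement_le r s t : 0 <= s -> s <= t -> psi r s <= psi r t.
Proof.
move=> s0 st.
have E u : 0 <= u -> psi r u = m (eball 0 r `\` eball (u *: e) r).
  by move=> u0; rewrite displacementE sub0r enormN enormZ e1 mulr1 ger0_norm.
rewrite !E//; last exact: le_trans st.
apply: (content_le mP) => // z [z0 zs]; split=> // zt; apply: zs.
move: s0; rewrite le_eqVlt => /predU1P[<-|s0]; first by rewrite scale0r.
have t0 : 0 < t by exact: lt_le_trans st.
(* [s *: e] is a convex combination of [0] and [t *: e]. *)
have k1 : 0 < s / t <= 1 by rewrite divr_gt0// ler_pdivrMr// mul1r.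
move: z0 zt; rewrite /eball /= subr0 => z0 zt.
have -> : z - s *: e = (1 - s / t) *: z + (s / t) *: (z - t *: e).
  by rewrite scalerBr scalerA divfK ?gt_eqF// scalerBl scale1r subrKA.
apply: le_lt_trans (enormD _ _) _; rewrite !enormZ.
move: k1; move: (s / t) => k /andP[k0 k1].
rewrite ger0_norm ?subr_ge0// ger0_norm ?(ltW k0)//.
by nra.
Qed.

Lemma displacementD r s t : 0 <= s -> 0 <= t -> psi r (s + t) <= psi r s + psi r t.
Proof.
move=> s0 t0.
have -> : psi r s = m (eball ((s + t) *: e) r `\` eball (t *: e) r).
  by rewrite displacementE -scalerBl addrK enormZ e1 mulr1 ger0_norm.
apply: le_trans (contentU mP (bD _ _ _) (bD _ _ _)).
apply: (content_le mP); last exact: eboundedU.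
move=> z [zst z0]; have [zt|zt] := pselect (eball (t *: e) r z).
  by right; split.
by left; split.
Qed.

Lemma displacementMn r s (n : nat) : 0 <= s -> psi r (n.+1%:R * s) <= n.+1%:R * psi r s.
Proof.
move=> s0; elim: n => [|n ih]; first by rewrite !mul1r.
rewrite -natr1 !mulrDl !mul1r; apply: le_trans (displacementD _ _ _) _ => //.
  by rewrite mulr_ge0.
by rewrite lerD2r.
Qed.

(** Subadditivity and monotonicity give a quantitative form of Fekete's lemma:
    the difference quotient at [s] nearly dominates the one at any [t] that is
    large compared to [s]. *)
Lemma displacement_fekete r s t : 0 < s -> 0 < t ->
  psi r t * s <= psi r s * (t + s).
Proof.
move=> s0 t0; have ts0 : 0 <= t / s by rewrite divr_ge0 ?(ltW t0) ?(ltW s0).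
have := truncn_itv ts0; set n := Num.truncn _ => /andP[n1 n2].
have h : psi r t <= n.+1%:R * psi r s.
  apply: le_trans (displacementMn r n (ltW s0)).
  by apply: displacement_le; [exact: ltW|rewrite -ler_pdivrMr// ltW].
apply: le_trans (ler_wpM2r (ltW s0) h) _.
rewrite mulrAC mulrC ler_wpM2l ?displacement_ge0//.
by rewrite -natr1 mulrDl mul1r lerD2r -ler_pdivlMr.
Qed.

(** The two balls are disjoint. *)
Lemma displacement_far r : 0 < r -> psi r (2 * r) = F r.
Proof.
move=> r0; rewrite -(content_ball mP ((2 * r) *: e)); congr m.
apply/seteqP; split => [z []//|z zr]; split=> // z0.
move: zr z0; rewrite /eball /= subr0 => zr z0.
have := enormB z ((2 * r) *: e) 0.
rewrite enormC in zr; rewrite !subr0 enormZ e1 mulr1 ger0_norm ?mulr_ge0 ?(ltW r0)//.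
by lra.
Qed.

Lemma displacement_le_ball r s : psi r s <= F r.
Proof.
by rewrite -(content_ball mP (s *: e)); apply: (content_le mP) => // z [].
Qed.

Section Chain.
Variables (r : R) (x : nat -> 'rV[R]_d) (n : nat).
Hypothesis rr : regular_radius m r.
Hypothesis xint : forall i k, (i <= k < n)%N ->
  eball (x i) r `&` eball (x k.+1) r `<=` eball (x k) r.

Let V k := \bigcup_(i in [set i | (i < k)%N]) eball (x i) r.

Let VS k : V k.+1 = V k `|` eball (x k) r.
Proof.
apply/seteqP; split=> [z [i /= + zi]|z [[i /= ik zi]|zk]].
- by rewrite ltnS leq_eqVlt => /predU1P[<-|ik]; [right|left; exists i].
- by exists i => //=; rewrite ltnS ltnW.
- by exists k => /=.
Qed.

Lemma ebounded_chain k : ebounded (V k).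
Proof.
elim: k => [|k ih]; last by rewrite VS; exact: eboundedU.
by exists 0 => z [i].
Qed.

(** The balls along the chain have the interval property, so the content that
    each new ball adds to the union is exactly what it adds to its
    predecessor. *)
Lemma chain_content :
  F r + \sum_(i < n) psi r (enorm (x i.+1 - x i))
  <= m (\bigcup_(i in [set i | (i <= n)%N]) eball (x i) r).
Proof.
rewrite -/(V n.+1); set U := V n.+1.
have bU : ebounded U by exact: ebounded_chain.
have bUD A : ebounded (U `\` A) by apply: ebounded_sub bU; exact: subDsetl.
have xU k : (k <= n)%N -> eball (x k) r `<=` U by move=> kn z zk; exists k.
suff /(_ n (leqnn n)) h : forall k, (k <= n)%N ->
    m (U `\` V k.+1) + (F r + \sum_(i < k) psi r (enorm (x i.+1 - x i))) <= m U.
  by apply: le_trans h; rewrite lerDr; exact: (content_ge0 mP (bUD _)).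
elim=> [_|k ih kn].
  rewrite big_ord0 addr0 addrC; apply: le_trans (content_split mP (x 0%N) rr bU).
  rewrite (setIidr (xU _ _))// (content_ball mP) lerD2l.
  apply: (content_le mP) => [z [Uz Vz]|]; last exact: bUD.
  by split=> // z0; apply: Vz; exists 0%N.
suff h : psi r (enorm (x k.+1 - x k)) + m (U `\` V k.+2) <= m (U `\` V k.+1).
  rewrite big_ord_recr /=; move: (ih (ltnW kn)) h.
  by set p := psi _ _; set S := \sum_(i < k) _; lra.
apply: le_trans (content_split mP (x k.+1) rr (bUD _)); apply: lerD; last first.
  apply: (content_le mP) => [z [Uz Vz]|]; last first.
    by apply: ebounded_sub (bUD (V k.+1)); exact: subDsetl.
  split; last first.
    by move=> zk; apply: Vz; exists k.+1 => /=.
  by split=> // Vz'; apply: Vz; rewrite VS; left.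
rewrite -displacementE; apply: (content_le mP); last first.
  by apply: ebounded_sub (bUD (V k.+1)); exact: subIsetl.
move=> z [zk1 zk]; split=> //; split; first exact: (xU k.+1).
move=> [i /= ik zi]; apply: zk; apply: (xint (i := i)) => //.
by rewrite -ltnS ik.
Qed.

End Chain.

(** Laying out a ball along a straight line at equal steps bounds the cost of a
    step. *)
Lemma displacement_lin r s : 0 < r -> regular_radius m r -> 0 < s ->
  psi r s <= F (r + 2) * s.
Proof.
move=> r0 rr s0; have Fr : F r <= F (r + 2) by apply: (ball_content_le mP); lra.
have F0 t : 0 <= F t by exact: (content_ge0 mP (bB _ _)).
have [s1|s1] := leP 1 s.
  apply: le_trans (displacement_le_ball r s) _.
  by apply: le_trans Fr _; rewrite ler_peMr.
have is0 : 0 <= s^-1 by rewrite invr_ge0 ltW.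
have := truncn_itv is0; set n := Num.truncn _ => /andP[n1 n2].
have ns1 : 1 <= n.+1%:R * s by rewrite -ler_pdivrMr// mul1r ltW.
have ns2 : n.+1%:R * s <= 2.
  rewrite -natr1 mulrDl mul1r; have : n%:R * s <= 1.
    by rewrite -ler_pdivlMr// mul1r.
  by lra.
pose x (i : nat) := (i%:R * s) *: e.
have xx i : enorm (x i.+1 - x i) = s.
  by rewrite -scalerBl -mulrBl enormZ e1 mulr1 -natr1 addrAC subrr add0r mul1r gtr0_norm.
have := @chain_content r x n.+1 rr.
under eq_bigr do rewrite xx.
rewrite sumr_const card_ord -[_ *+ n.+1]mulr_natl => h.
suff : F r + n.+1%:R * psi r s <= F (r + 2).
  move=> h1; have h2 : n.+1%:R * psi r s <= F (r + 2) by have := F0 r; lra.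
  apply: le_trans (ler_wpM2r (ltW s0) h2).
  by rewrite mulrAC ler_peMl// displacement_ge0.
apply: le_trans (h _) _ => {h}; last first.
  apply: (content_le mP) => // z [i /= ik]; rewrite /eball /= subr0.
  have := enormD (z - x i) (x i); rewrite subrK enormZ e1 mulr1.
  rewrite ger0_norm ?mulr_ge0 ?(ltW s0)//.
  have : i%:R * s <= n.+1%:R * s by rewrite ler_wpM2r ?(ltW s0)// ler_nat.
  by lra.
move=> i k /andP[ik kn] z [zi zk].
(* [x k] is a convex combination of [x i] and [x k.+1]. *)
have c0 : 0 < k.+1%:R - i%:R :> R by rewrite subr_gt0 ltr_nat ltnS.
pose c : R := (k.+1%:R - i%:R)^-1.
have cE : c * (k.+1%:R - i%:R) = 1 by rewrite mulVf// gt_eqF.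
have c1 : 0 < c <= 1.
  rewrite invr_gt0 c0 invf_le1// -natr1 lerBrDl; move: ik; rewrite -(ler_nat R).
  by lra.
have -> : eball (x k) r z = (enorm (c *: (z - x i) + (1 - c) *: (z - x k.+1)) < r).
  rewrite /eball /=; congr (enorm _ < _ : Prop).
  rewrite /x !scalerBr !scalerA addrACA -scalerDl subrKC scale1r -opprD -scalerDl.
  congr (z - _ *: e); have := congr1 ( *%R s) cE; rewrite -natr1; lra.
move: zi zk; rewrite /eball /= => zi zk.
apply: le_lt_trans (enormD _ _) _; rewrite !enormZ.
have /andP[c2 c3] := c1.
rewrite gtr0_norm// ger0_norm ?subr_ge0//.
by nra.
Qed.

(** The ball around a new vertex adds at most what it adds to the ball around
    its parent. *)
Lemma tree_content r c (q : seq 'rV[R]_d) (l : R) :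
  (forall t, 0 <= t -> psi r t <= c * t) ->
  tree q l -> m (\bigcup_(x in [set` q]) eball x r) <= F r + c * l.
Proof.
move=> cP.
pose U (q : seq 'rV[R]_d) := \bigcup_(x in [set` q]) eball x r.
have UE x (q' : seq 'rV[R]_d) : U (x :: q') `<=` U q' `|` eball x r.
  move=> z [y /=]; rewrite inE => /predU1P[->|yq] zy; first by right.
  by left; exists y.
have bU q' : ebounded (U q') by exact: ebounded_balls.
elim=> [x|{}q {}l x p pq _ ih].
  rewrite mulr0 addr0 -(content_ball mP x); apply: (content_le mP) => //.
  by move=> z /UE[[]|].
rewrite mulrDr addrA; apply: le_trans (lerD ih (cP _ (enorm_ge0 (x - p)))).
rewrite -displacementE; apply: le_trans (contentU mP (bU _) (bD _ _ _)).
apply: (content_le mP); last exact: eboundedU.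
move=> z /UE[?|zx]; first by left.
have [zp|zp] := pselect (eball p r z); last by right.
by left; exists p.
Qed.

End Displacement.

(** * Approximating a continuum by finite trees *)

Lemma lte_EFin_between {R : realType} (x : \bar R) (y : R) : (0 <= x)%E ->
  (x < y%:E)%E -> exists2 z, (x < z%:E)%E & z < y.
Proof.
case: x => [x| |]//= _; rewrite lte_fin => xy.
by exists ((x + y) / 2); rewrite ?lte_fin; lra.
Qed.

Section Hausdorff.
Context {R : realType} {d : nat}.
Implicit Types (A S : set 'rV[R]_d) (x y z : 'rV[R]_d).

Lemma ediam_ge0 A : (0 <= ediam A)%E.
Proof. by rewrite /ediam le_max lexx. Qed.

Lemma ediam_ub A x y : A x -> A y -> ((enorm (x - y))%:E <= ediam A)%E.
Proof.
move=> Ax Ay; rewrite /ediam le_max; apply/orP; right.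
by apply: ereal_sup_ubound; exists (x, y).
Qed.

Lemma ediam_le A (c : R) : 0 <= c ->
  (forall x y, A x -> A y -> enorm (x - y) <= c) -> (ediam A <= c%:E)%E.
Proof.
move=> c0 Ac; rewrite /ediam ge_max lee_fin c0 /=.
by apply: ge_ereal_sup => _ [[x y] [/= Ax Ay] <-]; rewrite lee_fin Ac.
Qed.

Lemma hausdorff1_pre_ge0 (delta : R) A : (0 <= hausdorff1_pre delta A)%E.
Proof.
apply: le_ereal_inf_tmp => _ [U _ <-].
by apply: nneseries_ge0 => i _ _; exact: ediam_ge0.
Qed.

Lemma hausdorff1_ge0 A : (0 <= hausdorff1 A)%E.
Proof.
apply: le_trans (hausdorff1_pre_ge0 1 A) _.
by apply: ereal_sup_ubound; exists 1 => //=; exact: ltr01.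
Qed.

Lemma hausdorff1_cover A (H delta : R) : 0 < delta -> (hausdorff1 A < H%:E)%E ->
  exists U : nat -> set 'rV[R]_d, [/\ A `<=` \bigcup_i U i,
    forall i, (ediam (U i) <= delta%:E)%E &
    (\sum_(0 <= i <oo) ediam (U i) < H%:E)%E].
Proof.
move=> d0 AH; have : (hausdorff1_pre delta A < H%:E)%E.
  by apply: le_lt_trans AH; apply: ereal_sup_ubound; exists delta.
by move=> /ereal_inf_lt[_ [U [AU Ud] <-] UH]; exists U.
Qed.

Section Attach.
Variables (V : nat -> set 'rV[R]_d) (dm : nat -> R) (delta : R).
Hypothesis dmP : forall i x y, V i x -> V i y -> enorm (x - y) <= dm i.
Hypothesis dm_le : forall i, dm i <= delta.

Definition meet_rel : rel nat := fun i j => `[< (V i `&` V j) !=set0 >].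

(** The tree [q] is paid for by the sets listed in [J], each used once, and [k]
    extra edges of length at most [delta]. *)
Record paid_tree (q : seq 'rV[R]_d) (l : R) (J : seq nat) (k : nat) : Prop := PaidTree {
  paid_tree_tree : tree q l;
  paid_tree_uniq : uniq J;
  paid_tree_mem : forall j, j \in J -> exists2 x, x \in q & V j x;
  paid_tree_le : l <= \sum_(j <- J) dm j + k%:R * delta }.

(** The case in which [y] lies in a set already used. *)
Lemma paid_tree_near i q l J k y : paid_tree q l J k -> i \in J -> V i y ->
  exists q' l', [/\ paid_tree q' l' J k.+1, y \in q' & {subset q <= q'}].
Proof.
move=> qP iJ Viy; have [x xq Vix] := paid_tree_mem qP iJ.
exists (y :: q), (l + enorm (y - x)); split.
- split; [exact: tree_leaf (paid_tree_tree qP)|exact: paid_tree_uniq qP| |].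
    by move=> h /(paid_tree_mem qP)[w wq Vw]; exists w; rewrite // inE wq orbT.
  have := paid_tree_le qP; have := dmP Viy Vix; have := dm_le i.
  by rewrite -natr1 mulrDl mul1r; lra.
- exact: mem_head.
- by move=> w wq; rewrite inE wq orbT.
Qed.

(** Following a simple chain of sets from [y] towards the tree until the first
    set already used, one pays for each new set on the way, and one extra edge
    to reach the tree inside the used set. *)
Lemma paid_tree_attach p i q l J k y : paid_tree q l J k ->
    path meet_rel i p -> uniq (i :: p) -> last i p \in J -> V i y ->
  exists q' l' J', [/\ paid_tree q' l' J' k.+1, y \in q', {subset q <= q'},
    {subset J <= J'} & {subset J' <= J ++ (i :: p)}].
Proof.
elim: p i y => [|j p ih] i y qP ip up lJ Viy.
  have [q' [l' [? ? ?]]] := paid_tree_near qP lJ Viy.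
  by exists q', l', J; split=> // h hJ; rewrite mem_cat hJ.
have [iJ|iJ] := boolP (i \in J).
  have [q' [l' [? ? ?]]] := paid_tree_near qP iJ Viy.
  by exists q', l', J; split=> // h hJ; rewrite mem_cat hJ.
move: ip up lJ => /= /andP[/asboolP[z [Viz Vjz]] jp] /andP[ip up] lJ.
have [q' [l' [J' [qP' zq' qq' JJ' J'J]]]] := ih j z qP jp up lJ Vjz.
have iJ' : i \notin J'.
  by apply/negP => /J'J; rewrite mem_cat (negbTE iJ) (negbTE ip).
exists (y :: q'), (l' + enorm (y - z)), (i :: J'); split.
- split.
  + exact: tree_leaf (paid_tree_tree qP').
  + by rewrite /= iJ' (paid_tree_uniq qP').
  + move=> h; rewrite inE => /predU1P[->|].
      by exists y => //; exact: mem_head.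
    by move=> /(paid_tree_mem qP')[w wq Vw]; exists w; rewrite // inE wq orbT.
  + by rewrite big_cons; have := paid_tree_le qP'; have := dmP Viy Viz; lra.
- exact: mem_head.
- by move=> w /qq' wq; rewrite inE wq orbT.
- by move=> h /JJ' hJ; rewrite inE hJ orbT.
- move=> h; rewrite inE => /predU1P[->|/J'J].
    by rewrite mem_cat mem_head orbT.
  by rewrite !mem_cat !inE => /or3P[] ->; rewrite ?orbT.
Qed.

(** Members of an open cover that meet the connected set are joined by chains
    of members: otherwise the cover would separate it. *)
Lemma connected_chain S i0 : connected S -> (forall i, open (V i)) ->
  S `<=` \bigcup_i V i -> (S `&` V i0) !=set0 ->
  forall y, S y -> exists i p,
    [/\ V i y, path meet_rel i p, uniq (i :: p) & last i p = i0].
Proof.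
move=> cS oV SV Si0.
pose reach i := exists2 p, path meet_rel i p & last i p = i0.
pose W (P : set nat) := \bigcup_(i in P) V i.
have oW P : open (W P) by apply: bigcup_open => i _.
have SE : S `&` W reach = S.
  apply: cS.
  - by case: Si0 => x [Sx Vx]; exists x; split=> //; exists i0 => //; exists [::].
  - by exists (W reach).
  - exists (~` W (~` reach)); first by rewrite closedC.
    apply/seteqP; split=> x [Sx].
      move=> [i [p ip pi0] Vix]; split=> // -[j jr Vjx]; apply: jr.
      exists (i :: p) => //=; rewrite ip andbT; apply/asboolP.
      by exists x.
    move=> nx; split=> //; have [i _ Vix] := SV x Sx.
    by have [ir|ir] := pselect (reach i); [exists i|case: nx; exists i].
move=> y; rewrite -SE => -[Sy [i [p ip pi0] Viy]].
case: (shortenP ip) pi0 => p' ip' up' _ pi0.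
by exists i, p'; split.
Qed.

Lemma exists_paid_tree S x0 : connected S -> (forall i, open (V i)) ->
  S `<=` \bigcup_i V i -> S x0 -> forall ys : seq 'rV[R]_d,
  (forall y, y \in ys -> S y) -> 0 <= delta ->
  exists q l J, paid_tree q l J (size ys) /\ {subset ys <= q}.
Proof.
move=> cS oV SV Sx0 ys ysS delta0; have [i0 _ Vi0] := SV x0 Sx0.
have chain := connected_chain cS oV SV (ex_intro _ x0 (conj Sx0 Vi0)).
suff [q [l [J [? ? _]]]] : exists q l J,
    [/\ paid_tree q l J (size ys), {subset ys <= q} & i0 \in J].
  by exists q, l, J.
elim: ys ysS => [_|y ys ih ysS].
  exists [:: x0], 0, [:: i0]; split=> //; last exact: mem_head.
  split=> //; first exact: tree_root.
    move=> j; rewrite inE => /eqP ->; exists x0 => //; exact: mem_head.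
  rewrite big_seq1 mul0r addr0; apply: le_trans (dmP Vi0 Vi0).
  exact: enorm_ge0.
have [q [l [J [qP ysq i0J]]]] : exists q l J,
    [/\ paid_tree q l J (size ys), {subset ys <= q} & i0 \in J].
  by apply: ih => z zys; apply: ysS; rewrite inE zys orbT.
have [i [p [Viy ip uip pi0]]] := chain y (ysS y (mem_head _ _)).
have [|q' [l' [J' [? yq' qq' JJ' _]]]] := paid_tree_attach qP ip uip _ Viy.
  by rewrite pi0.
exists q', l', J'; split=> //; last exact: JJ'.
by move=> z; rewrite inE => /predU1P[->//|/ysq/qq'].
Qed.

End Attach.

Lemma sum_uniq_le (f : nat -> R) (J : seq nat) : (forall i, 0 <= f i) -> uniq J ->
  exists N, \sum_(j <- J) f j <= \sum_(0 <= j < N) f j.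
Proof.
move=> f0 uJ; exists (\max_(j <- J) j).+1; set N := _.+1.
have JN j : j \in J -> (j < N)%N by move=> jJ; rewrite ltnS; exact: leq_bigmax_seq.
rewrite (perm_big [seq j <- index_iota 0 N | j \in J]).
  rewrite big_filter big_mkcond; apply: ler_sum => i _; by case: ifP.
apply: uniq_perm => //; first by rewrite filter_uniq// iota_uniq.
move=> j; rewrite mem_filter mem_index_iota /=.
by case jJ : (j \in J) => //=; rewrite JN.
Qed.

(** A continuum is approximated by finite trees whose length exceeds its own by
    as little as desired. A finite [eta]-net of [S] is fixed first; then [S] is
    covered by sets so small that the extra edges, one for each point of the net,
    have a negligible total length, and the points of the net are attached one
    after the other. *)
Lemma exists_tree S (H eta : R) : compact S -> connected S -> S !=set0 ->
    (hausdorff1 S < H%:E)%E -> 0 < eta ->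
  exists q l, [/\ tree q l, l <= H & S `<=` \bigcup_(x in [set` q]) eball x eta].
Proof.
move=> kS cS [x0 Sx0] SH eta0.
have [ys ysS Sys] : exists2 ys : seq 'rV[R]_d, (forall y, y \in ys -> S y) &
    S `<=` \bigcup_(x in [set` ys]) eball x eta.
  move: kS; rewrite compact_cover => /(_ 'rV[R]_d S (fun c => eball c eta)).
  case=> [c _|x Sx|D DS cov]; first exact: open_eball.
    by exists x => //; exact: eball_center.
  exists (finmap.enum_fset D) => // y yD; exact/set_mem/DS.
have [H' SH' H'H] := lte_EFin_between (hausdorff1_ge0 S) SH.
(* Half of the margin [eps] pays for the [K] extra edges, each of length at most
   [3 * delta], the other half for thickening the cover into open sets. *)
pose K := size ys; pose eps := H - H'; have eps0 : 0 < eps by rewrite subr_gt0.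
pose delta := eps / (6 * (K.+1)%:R).
have delta0 : 0 < delta by rewrite divr_gt0// mulr_gt0.
pose t := Num.min delta (eps / 4).
have t0 : 0 < t by rewrite lt_min delta0 divr_gt0.
have [t1 t2] : t <= delta /\ t <= eps / 4 by rewrite /t !ge_min !lexx orbT.
have [U [SU Ud UH]] := hausdorff1_cover delta0 SH'.
pose tau (i : nat) := t / 2 ^+ i.+1.
have tau0 i : 0 < tau i by rewrite divr_gt0// exprn_gt0.
have taut i : tau i <= t.
  by rewrite ler_pdivrMr ?exprn_gt0// ler_peMr ?(ltW t0)// exprn_ege1// ler1n.
have sum_tau N : \sum_(0 <= i < N) tau i <= t.
  suff -> : \sum_(0 <= i < N) tau i = t - t / 2 ^+ N.
    by rewrite gerBl divr_ge0 ?(ltW t0)// exprn_ge0.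
  elim: N => [|N ih]; first by rewrite big_geq// expr0 divr1 subrr.
  rewrite big_nat_recr //= ih /tau exprS.
  by field; rewrite expf_neq0.
have fU i : ediam (U i) \is a fin_num.
  rewrite ge0_fin_numE ?ediam_ge0//; exact: le_lt_trans (Ud i) (ltry _).
pose V i := \bigcup_(u in U i) eball u (tau i).
pose dm i := fine (ediam (U i)) + 2 * tau i.
have dm0 i : 0 <= dm i.
  by rewrite addr_ge0 ?fine_ge0 ?ediam_ge0// mulr_ge0// ltW.
have dmP i x y : V i x -> V i y -> enorm (x - y) <= dm i.
  move=> [u Uu xu] [v Uv yv]; move: xu yv; rewrite /eball /= => xu yv.
  have := ediam_ub Uu Uv; rewrite -(fineK (fU i)) lee_fin => uv.
  have := enormB u x y; have := enormB v u y; move: yv; rewrite (enormC y v).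
  by rewrite /dm; lra.
have dm_le i : dm i <= 3 * delta.
  have := Ud i; rewrite -(fineK (fU i)) lee_fin; have := taut i; rewrite /dm.
  by lra.
have oV i : open (V i) by apply: bigcup_open => u _; exact: open_eball.
have SV : S `<=` \bigcup_i V i.
  by move=> x /SU[i _ Ux]; exists i => //; exists x => //; exact: eball_center.
have d30 : 0 <= 3 * delta by rewrite mulr_ge0// ltW.
have [q [l [J [[tq uJ _ lJ] ysq]]]] :=
  exists_paid_tree dmP dm_le cS oV SV Sx0 ysS d30.
exists q, l; split=> //; last first.
  by move=> x /Sys[y /= /ysq yq xy]; exists y.
have [N JN] := sum_uniq_le dm0 uJ.
have sU : \sum_(0 <= i < N) fine (ediam (U i)) <= H'.
  rewrite -lee_fin -sumEFin; apply: le_trans (ltW UH).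
  under eq_bigr do rewrite fineK//.
  by apply: nneseries_lim_ge => i _ _; exact: ediam_ge0.
have : K%:R * (3 * delta) <= eps / 2.
  rewrite /delta -natr1 ler_pdivlMr//.
  have k0 : 0 <= K%:R :> R by [].
  rewrite [leLHS](_ : _ = eps * (K%:R / (K%:R + 1))); last first.
    by field; rewrite natr1 pnatr_eq0.
  by rewrite ler_piMr ?(ltW eps0)// ler_pdivrMr; lra.
have sdm : \sum_(0 <= i < N) dm i <= H' + 2 * t.
  by rewrite big_split /= -mulr_sumr lerD// ler_wpM2l.
by move: lJ JN sdm t2; rewrite -/K /eps; lra.
Qed.

End Hausdorff.

(** * Metric estimates on a curve of class C11 *)

Section Curve.
Context {R : realType} {d : nat} (L C : R) (g g' : R -> 'rV[R]_d).
Hypothesis L0 : 0 < L.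
Hypothesis gL : arc_length_param L g.
Hypothesis gD : derivative_on L g g'.
Hypothesis C0 : 0 < C.
Hypothesis gC : {in `[0, L] &, forall s t : R, enorm (g' s - g' t) <= C * `|s - t|}.
Implicit Types (s t u w : R) (x y z e : 'rV[R]_d).

Lemma chord_le s t : 0 <= s -> s <= t -> t <= L -> enorm (g t - g s) <= t - s.
Proof.
move=> s0; rewrite le_eqVlt => /predU1P[<-|st] tL; first by rewrite !subrr enorm0.
have [_ /(_ s t s0 (ltW st) tL) h] := gL.
rewrite -lee_fin -h; apply: ereal_sup_ubound; exists [:: t].
  by split=> /=; rewrite ?st.
by rewrite /polygon_length /= big_nat1.
Qed.

Lemma chord_le_abs s t : s \in `[0, L] -> t \in `[0, L] ->
  enorm (g t - g s) <= `|t - s|.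
Proof.
rewrite !in_itv /= => /andP[s0 sL] /andP[t0 tL].
have [st|ts] := lerP s t; first exact: chord_le.
by rewrite enormC (chord_le t0 (ltW ts) sL).
Qed.

Lemma continuous_dotv e : continuous (fun x : 'rV[R]_d => dotv x e).
Proof.
apply: continuous_big => [|i _ x]; first by move=> p; exact: add_continuous.
apply: (@continuous_comp _ _ _ (fun y : 'rV[R]_d => y 0 i) ( *%R^~ (e 0 i))).
  exact: coord_continuous.
exact: mulrr_continuous.
Qed.

(** The mean value theorem fails for vectors, but holds for each component; the
    estimates below apply it in the direction [e] of the vector to bound. *)
Lemma curve_mvt e u w : 0 <= u -> u < w -> w <= L ->
  exists2 t, u <= t <= w & dotv (g w - g u) e = (w - u) * dotv (g' t) e.
Proof.
move=> u0 uw wL; pose f t := dotv (g t) e.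
have fd t : t \in `]u, w[%R -> is_derive t 1 f (dotv (g' t) e).
  rewrite in_itv /= => /andP[ut tw].
  have t0L : t \in `[0, L].
    by rewrite in_itv /= (ltW (le_lt_trans u0 ut)) (ltW (lt_le_trans tw wL)).
  have h : (s - t)^-1 * (f s - f t) @[s --> within `[0, L] t^'] --> dotv (g' t) e.
    have := cvg_comp _ _ (gD t0L) (@continuous_dotv e (g' t)).
    apply: cvg_trans; apply: near_eq_cvg; apply: nearW => s /=.
    by rewrite dotvZl dotvDl dotvNl.
  have sh : h + t @[h --> 0^'] --> within `[0, L] t^'.
    move=> A /= /nbhs_ballP [r /= r0 rA].
    have r'0 : 0 < Num.min r (Num.min (t - u) (w - t)).
      by rewrite !lt_min r0 !subr_gt0 ut tw.
    apply/nbhs_ballP; exists (Num.min r (Num.min (t - u) (w - t))) => //= k.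
    rewrite /ball /= sub0r normrN !lt_min => /and3P[kr /ltW ku /ltW kw] k0.
    apply: rA => /=.
    - by rewrite /ball /= opprD addrCA subrr addr0 normrN.
    - by rewrite -subr_eq0 addrK.
    - move: ku kw; rewrite in_itv /= !ler_norml => /andP[ku _] /andP[_ kw].
      by apply/andP; split; lra.
  have k : h^-1 *: (f (h *: 1 + t) - f t) @[h --> (0:R)^'] --> dotv (g' t) e.
    have := cvg_comp _ _ sh h.
    apply: cvg_trans; apply: near_eq_cvg; apply: nearW => s /=.
    by rewrite addrK /GRing.scale /= mulr1.
  apply: DeriveDef; first by apply/cvg_ex; exists (dotv (g' t) e).
  exact: cvg_lim k.
have fc : {within `[u, w], continuous f}.
  have [gc _] := gL.
  have : {within `[u, w], continuous g}.
    apply: continuous_subspaceW gc => t /=; rewrite !in_itv /= => /andP[ut tw].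
    by rewrite (le_trans u0 ut) (le_trans tw wL).
  move=> {}gc t; apply: (@continuous_comp (subspace `[u, w]) _ _ g (fun x => dotv x e)).
    exact: gc.
  exact: continuous_dotv.
have [t tuw ft] := MVT uw fd fc.
exists t; first by move: tuw; rewrite in_itv /= => /andP[/ltW -> /ltW ->].
by rewrite mulrC -ft /f dotvDl dotvNl.
Qed.

Lemma taylor_curve u w : 0 <= u -> u < w -> w <= L ->
  enorm (g w - g u - (w - u) *: g' u) <= C * (w - u) ^+ 2.
Proof.
move=> u0 uw wL; set v := _ - _ *: _.
have [t /andP[ut tw] tE] := curve_mvt v u0 uw wL.
have [v0|v0] := eqVneq (enorm v) 0.
  by rewrite v0 mulr_ge0 ?sqr_ge0 ?(ltW C0).
have vp : 0 < enorm v by rewrite lt_def v0 enorm_ge0.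
have gt : enorm (g' t - g' u) <= C * (w - u).
  apply: le_trans (gC _ _) _; rewrite ?in_itv /= ?(le_trans u0 ut) ?(le_trans tw wL)//.
    by rewrite u0 (le_trans (ltW uw) wL).
  by rewrite ler_wpM2l ?(ltW C0)// ger0_norm ?subr_ge0//; lra.
have : enorm v ^+ 2 <= (w - u) * (C * (w - u)) * enorm v.
  have -> : enorm v ^+ 2 = (w - u) * dotv (g' t - g' u) v.
    have -> : enorm v ^+ 2 = dotv (g w - g u) v - (w - u) * dotv (g' u) v.
      by rewrite -dotvZl -dotvNl -dotvDl enorm_sqr.
    by rewrite tE dotvDl dotvNl mulrBr.
  rewrite -mulrA ler_wpM2l ?subr_ge0 ?(ltW uw)//.
  apply: le_trans (dotv_le _ _) _.
  by rewrite ler_wpM2r ?(ltW vp).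
by rewrite expr2 ler_pM2r// mulrCA -expr2.
Qed.

(** An inscribed polygon has length at most [enorm (g' u) + C * (w - u)] times
    [w - u], whereas these lengths have supremum [w - u]. *)
Lemma deriv_norm_ge u w : 0 <= u -> u < w -> w <= L ->
  1 - C * (w - u) <= enorm (g' u).
Proof.
move=> u0 uw wL; have [_ /(_ u w u0 (ltW uw) wL) len] := gL.
have h0 : 0 < w - u by rewrite subr_gt0.
pose c := enorm (g' u) + C * (w - u).
have c0 : 0 <= c by rewrite addr_ge0 ?enorm_ge0// mulr_ge0 ?ltW.
have edge (x y : R) : u <= x -> x < y -> y <= w -> enorm (g y - g x) <= c * (y - x).
  move=> ux xy yw; have x0 := le_trans u0 ux; have yL := le_trans yw wL.
  set v := g y - g x.
  have [t /andP[xt ty] tE] := curve_mvt v x0 xy yL.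
  have [v0|v0] := eqVneq (enorm v) 0.
    by rewrite v0 mulr_ge0 ?subr_ge0 ?(ltW xy).
  have vp : 0 < enorm v by rewrite lt_def v0 enorm_ge0.
  have tc : enorm (g' t) <= c.
    have := enormB (g' u) (g' t) 0; rewrite !subr0.
    have : enorm (g' t - g' u) <= C * (w - u).
      apply: le_trans (gC _ _) _; rewrite ?in_itv /= ?(le_trans x0 xt) ?(le_trans ty yL)//.
        by rewrite u0 (le_trans (ltW uw) wL).
      by rewrite ler_wpM2l ?(ltW C0)// ger0_norm ?subr_ge0//; lra.
    by rewrite /c; lra.
  have : enorm v ^+ 2 <= c * (y - x) * enorm v.
    rewrite enorm_sqr tE mulrAC mulrC ler_wpM2r ?subr_ge0 ?(ltW xy)//.
    by apply: le_trans (dotv_le _ _) _; rewrite ler_wpM2r ?(ltW vp).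
  by rewrite expr2 ler_pM2r.
suff : ((w - u)%:E <= (c * (w - u))%:E)%E.
  rewrite lee_fin -[X in X <= _]mul1r ler_pM2r// /c; lra.
rewrite -len; apply: ge_ereal_sup => _ [s us <-]; rewrite lee_fin.
rewrite /polygon_length; set F := nth w (u :: s).
have Fs : F (size s) = w.
  by have [_ /eqP <-] := us; rewrite /F nth_last.
rewrite -[X in _ <= _ * (X - _)]Fs -[X in _ <= _ * (_ - X)]/(F 0%N).
rewrite -telescope_sumr// mulr_sumr.
apply: ler_sum_nat => i /andP[_ iS].
apply: edge.
- exact: (itv_partition_nth_ge (leqW iS) us).
- by have [/(pathP w) /(_ i iS)] := us.
- exact: (itv_partition_nth_le (m := i.+1) iS us).
Qed.

Lemma chord_ge u w : 0 <= u -> u <= w -> w <= L ->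
  (w - u) * (1 - 2 * C * (w - u)) <= enorm (g w - g u).
Proof.
move=> u0; rewrite le_eqVlt => /predU1P[<-|uw] wL.
  by rewrite !subrr mul0r enorm0.
have h0 : 0 < w - u by rewrite subr_gt0.
have h1 := taylor_curve u0 uw wL; have h2 := deriv_norm_ge u0 uw wL.
have := enormB (g w - g u) ((w - u) *: g' u) 0.
rewrite !subr0 enormC enormZ gtr0_norm//.
have := ler_wpM2l (ltW h0) h2; move: h1; rewrite (expr2 (w - u)).
by lra.
Qed.

(** The vector is [w - u] times the deviation of [g t] from the affine
    interpolation between [g u] and [g w]; the factor [(t - u) * (w - t)] on the
    right matches the convexity gain in [ball_interval_near]. *)
Lemma second_difference u t w : 0 <= u -> u < t -> t < w -> w <= L ->
  enorm ((w - t) *: (g t - g u) - (t - u) *: (g w - g t))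
  <= C * ((t - u) * (w - t) * (w - u)).
Proof.
move=> u0 ut tw wL; set v := _ - _.
have t0 : 0 <= t by rewrite ltW// (le_lt_trans u0).
have tL : t <= L by rewrite ltW// (lt_le_trans tw).
have [a /andP[ua at_] aE] := curve_mvt v u0 ut tL.
have [b /andP[tb bw] bE] := curve_mvt v t0 tw wL.
have p0 : 0 < (t - u) * (w - t) by rewrite mulr_gt0 ?subr_gt0.
have uw := lt_trans ut tw.
have [v0|v0] := eqVneq (enorm v) 0.
  by rewrite v0 !mulr_ge0 ?subr_ge0 ?(ltW C0) ?(ltW ut) ?(ltW tw) ?(ltW uw).
have vp : 0 < enorm v by rewrite lt_def v0 enorm_ge0.
have ab : enorm (g' a - g' b) <= C * (w - u).
  apply: le_trans (gC _ _) _; rewrite ?in_itv /= ?(le_trans u0 ua) ?(le_trans t0 tb)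
    ?(le_trans at_ tL) ?(le_trans bw wL)//.
  by rewrite ler_wpM2l ?(ltW C0)// ler_norml; apply/andP; split; lra.
have : enorm v ^+ 2 <= C * ((t - u) * (w - t) * (w - u)) * enorm v.
  have -> : enorm v ^+ 2 = (t - u) * (w - t) * dotv (g' a - g' b) v.
    have -> : enorm v ^+ 2
        = (w - t) * dotv (g t - g u) v - (t - u) * dotv (g w - g t) v.
      by rewrite -!dotvZl -dotvNl -dotvDl enorm_sqr.
    by rewrite aE bE dotvDl dotvNl; ring.
  rewrite [leRHS](_ : _ = (t - u) * (w - t) * (C * (w - u) * enorm v)); last by ring.
  rewrite ler_wpM2l ?(ltW p0)//.
  apply: le_trans (dotv_le _ _) _.
  by rewrite ler_wpM2r ?(ltW vp).
by rewrite expr2 ler_pM2r.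
Qed.

(** Along a short arc the squared distance to a point [z] at distance less than
    [r] of its ends is strictly convex up to the error of interpolation, so it
    stays below [r ^+ 2]. *)
Lemma ball_interval_near r u t w z : 0 < r -> 16 * C * r <= 1 ->
    0 <= u -> u <= t -> t <= w -> w <= L -> 4 * C * (w - u) <= 1 ->
  eball (g u) r z -> eball (g w) r z -> eball (g t) r z.
Proof.
move=> r0 Cr u0; rewrite le_eqVlt => /predU1P[<-//|ut].
rewrite le_eqVlt => /predU1P[->//|tw] wL Ch.
rewrite /eball /= => zu zw; have uw := lt_trans ut tw.
have h0 : 0 < w - u by rewrite subr_gt0.
have p0 : 0 < t - u by rewrite subr_gt0.
have q0 : 0 < w - t by rewrite subr_gt0.
have := chord_ge u0 (ltW uw) wL; have := second_difference u0 ut tw wL.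
set v := _ - (t - u) *: _; set D := enorm (g w - g u) => vle Dge.
pose P := (w - t) *: (z - g u) + (t - u) *: (z - g w).
have PE : (w - u) *: (z - g t) = P - v.
  rewrite /P /v !scalerBr; rewrite (_ : w - u = (w - t) + (t - u)); last by ring.
  rewrite !scalerDl; apply/rowP => i; rewrite !mxE; ring.
have P2 : enorm P ^+ 2 = (w - u) * ((w - t) * enorm (z - g u) ^+ 2
    + (t - u) * enorm (z - g w) ^+ 2) - (t - u) * (w - t) * D ^+ 2.
  have -> : D = enorm ((z - g u) - (z - g w)).
    by rewrite opprB addrC addrA subrK.
  rewrite !enorm_sqr /P; move: (z - g u) (z - g w) => x y.
  by rewrite !dotvE (dotvC y x); ring.
have Pr : enorm P <= (w - u) * r.
  apply: le_trans (enormD _ _) _; rewrite !enormZ !gtr0_norm//.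
  have := ler_wpM2l (ltW p0) (ltW zw); have := ler_wpM2l (ltW q0) (ltW zu); lra.
have D2 : (w - u) / 2 <= D.
  apply: le_trans Dge; rewrite ler_pM2l//; move: Ch; lra.
(* [P] is [w - u] times the vector to [z] from the interpolated point: its square
   has the convexity gain [(t - u) * (w - t) * D ^+ 2], of which the error
   terms involving [v] consume at most three quarters. *)
suff : ((w - u) * enorm (z - g t)) ^+ 2 < ((w - u) * r) ^+ 2.
  rewrite ltr_pXn2r ?nnegrE ?mulr_ge0 ?enorm_ge0 ?(ltW h0) ?(ltW r0)//.
  by rewrite ltr_pM2l.
have -> : (w - u) * enorm (z - g t) = enorm (P - v).
  by rewrite -PE enormZ gtr0_norm.
have k0 : 0 < (t - u) * (w - t) by rewrite mulr_gt0.
have Pv : enorm (P - v) ^+ 2 <= (enorm P + enorm v) ^+ 2.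
  rewrite ler_pXn2r ?nnegrE ?addr_ge0 ?enorm_ge0//.
  by rewrite -(enormN v) enormD.
apply: le_lt_trans Pv _; rewrite sqrrD P2.
have vn := enorm_ge0 v; have Pn := enorm_ge0 P.
have zu2 : enorm (z - g u) ^+ 2 <= r ^+ 2.
  by rewrite ler_pXn2r ?nnegrE ?enorm_ge0 ?(ltW r0) ?(ltW zu).
have zw2 : enorm (z - g w) ^+ 2 <= r ^+ 2.
  by rewrite ler_pXn2r ?nnegrE ?enorm_ge0 ?(ltW r0) ?(ltW zw).
have b1 : (w - u) * ((w - t) * enorm (z - g u) ^+ 2
    + (t - u) * enorm (z - g w) ^+ 2) <= (w - u) ^+ 2 * r ^+ 2.
  rewrite (expr2 (w - u)) -mulrA ler_wpM2l ?(ltW h0)//.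
  by have := ler_wpM2l (ltW p0) zw2; have := ler_wpM2l (ltW q0) zu2; lra.
have b2 : (t - u) * (w - t) * ((w - u) ^+ 2 / 4) <= (t - u) * (w - t) * D ^+ 2.
  rewrite ler_wpM2l ?(ltW k0)//.
  have -> : (w - u) ^+ 2 / 4 = ((w - u) / 2) ^+ 2 by field.
  by rewrite ler_pXn2r ?nnegrE ?enorm_ge0 ?divr_ge0 ?(ltW h0).
have b3 : enorm P * enorm v <= (t - u) * (w - t) * ((w - u) ^+ 2 / 16).
  apply: le_trans (ler_pM Pn vn Pr vle) _.
  have := ler_wpM2l (mulr_ge0 (ltW k0) (sqr_ge0 (w - u))) Cr; lra.
have b4 : enorm v ^+ 2 <= (t - u) * (w - t) * ((w - u) ^+ 2 / 16).
  have pq : (t - u) * (w - t) <= (w - u) ^+ 2.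
    by rewrite expr2 ler_pM ?(ltW p0) ?(ltW q0)//; lra.
  apply: le_trans (_ : (C * ((t - u) * (w - t) * (w - u))) ^+ 2 <= _).
    by rewrite ler_pXn2r ?nnegrE ?mulr_ge0 ?(ltW C0) ?(ltW p0) ?(ltW q0) ?(ltW h0).
  have Ch2 : (C * (w - u)) ^+ 2 <= 16^-1.
    rewrite (_ : 16^-1 = (4^-1) ^+ 2 :> R); last by field.
    by rewrite ler_pXn2r ?nnegrE ?mulr_ge0 ?(ltW C0) ?(ltW h0)//; lra.
  rewrite (_ : (C * _) ^+ 2 =
    (t - u) * (w - t) * (((t - u) * (w - t)) * (C * (w - u)) ^+ 2)); last by ring.
  rewrite ler_wpM2l ?(ltW k0)//.
  by apply: ler_pM => //; [exact: ltW|exact: sqr_ge0].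
have b5 : 0 < (t - u) * (w - t) * ((w - u) ^+ 2 / 16).
  by rewrite mulr_gt0// divr_gt0// exprn_gt0.
by rewrite exprMn -mulr_natl; lra.
Qed.

End Curve.

(** * Simple curves *)

Section SimpleCurve.
Context {R : realType} {d : nat} (L : R) (g : R -> 'rV[R]_d).
Hypothesis L0 : 0 < L.
Hypothesis gL : arc_length_param L g.
Implicit Types (r s t u w : R) (x y z : 'rV[R]_d).

(** Compactness: the distance of two points of the curve has a positive minimum
    on the pairs of parameters at distance at least [delta]. *)
Lemma curve_separation delta : {in `[0, L] &, injective g} -> 0 < delta ->
  exists2 eta, 0 < eta & forall u w, u \in `[0, L] -> w \in `[0, L] ->
    delta <= `|w - u| -> eta <= enorm (g w - g u).
Proof.
move=> gI delta0.
pose K := (`[0, L] `*` `[0, L]) `&` [set p : R * R | delta <= `|p.2 - p.1|].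
have cdist : continuous (fun p : R * R => `|p.2 - p.1|).
  move=> p; apply: (@continuous_comp _ _ _ (fun q : R * R => q.2 - q.1) Num.norm).
    exact: (@cvgB R R _ (nbhs p) _ snd fst p.2 p.1 cvg_snd cvg_fst).
  exact: norm_continuous.
have kK : compact K.
  apply: compact_closedI.
    exact: (compact_setX (@segment_compact R 0 L) (@segment_compact R 0 L)).
  apply: (@preimage_closed _ _ _ [set s : R | delta <= s]) => [p _|].
    exact: cdist.
  exact: closed_ge.
have [K0|/set0P K0] := eqVneq K set0.
  exists 1 => // u w u0 w0 uw.
  suff : K (u, w) by rewrite K0.
  by [].
pose f (p : R * R) := enorm (g p.2 - g p.1).
have cf : {within K, continuous f}.
  apply/subspace_continuousP => p [[/= p1 p2] _].
  apply/cvgrPdist_lt => eps eps0; rewrite near_withinE.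
  have e20 : 0 < eps / 2 by rewrite divr_gt0.
  have c1 : fst @ nbhs p --> p.1 by exact: cvg_fst.
  have c2 : snd @ nbhs p --> p.2 by exact: cvg_snd.
  near=> q => -[[/= q1 q2] _].
  have h1 : `|p.1 - q.1| < eps / 2.
    by near: q; exact: (cvgr_dist_lt _ _ c1).
  have h2 : `|p.2 - q.2| < eps / 2.
    by near: q; exact: (cvgr_dist_lt _ _ c2).
  have := chord_le_abs gL p1 q1; have := chord_le_abs gL p2 q2.
  rewrite (distrC q.1) (distrC q.2) /f.
  have := enormB (g q.2) (g p.2) (g p.1); have := enormB (g q.1) (g q.2) (g p.1).
  have := enormB (g p.2) (g q.2) (g q.1); have := enormB (g p.1) (g p.2) (g q.1).
  rewrite (enormC (g p.1)) (enormC (g p.2) (g q.2)) ltr_norml => *.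
  rewrite /from_subspace.
  by apply/andP; split; lra.
have [c cK cmin] := compact_EVT_min K0 kK cf.
move: cK; rewrite inE => -[[/= c1 c2] c12].
exists (f c).
  rewrite lt_def enorm_ge0 andbT; apply/negP => /eqP /enorm_eq0 /eqP.
  rewrite subr_eq0 => /eqP /(gI _ _ c2 c1) c21.
  by move: c12; rewrite /= c21 subrr normr0 leNgt delta0.
move=> u w u0 w0 uw; apply: (cmin (u, w)); rewrite inE; split => //.
Unshelve. all: by end_near. Qed.

(** Cutting the curve into arcs of equal length. *)
Lemma hausdorff1_curve : (hausdorff1 (g @` `[0%R, L]) <= L%:E)%E.
Proof.
apply: ge_ereal_sup => _ [delta /= delta0 <-].
pose n := Num.truncn (L / delta).
have n1 : L / n.+1%:R <= delta.
  have := truncn_itv (divr_ge0 (ltW L0) (ltW delta0)) => /andP[_ /ltW].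
  by rewrite ler_pdivrMr// mulrC -ler_pdivrMr.
pose h := L / n.+1%:R; have h0 : 0 < h by rewrite divr_gt0.
have nh : n.+1%:R * h = L by rewrite mulrC divfK.
pose U (i : nat) : set 'rV[R]_d :=
  if (i < n.+1)%N then g @` `[i%:R * h, i.+1%:R * h] else set0.
have UL (i : nat) s : (i < n.+1)%N -> s \in `[i%:R * h, i.+1%:R * h] -> s \in `[0, L].
  move=> iN; rewrite !in_itv /= => /andP[s1 s2]; apply/andP; split.
    by apply: le_trans s1; rewrite mulr_ge0// ltW.
  by apply: (le_trans s2); rewrite -nh ler_wpM2r ?(ltW h0)// ler_nat.
have dU i : (ediam (U i) <= (if (i < n.+1)%N then h else 0)%:E)%E.
  rewrite /U; case: ifPn => [iN|_]; apply: ediam_le => //; first exact: ltW.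
  move=> _ _ [s si <-] [t ti <-]; apply: le_trans (chord_le_abs gL _ _) _.
  - exact: UL ti.
  - exact: UL si.
  - move: si ti; rewrite /= !in_itv /= -natr1 mulrDl mul1r => /andP[? ?] /andP[? ?].
    by rewrite ler_norml; apply/andP; split; lra.
apply: ge_ereal_inf; exists (\sum_(0 <= i <oo) ediam (U i))%E.
  exists U => //; split.
    move=> _ [t /= tL <-].
    have [t0|t0] := eqVneq t L.
      exists n => //; rewrite /U ltnSn; exists t => //=.
      rewrite in_itv /= t0 nh lexx andbT -nh ler_wpM2r ?(ltW h0)//.
      by rewrite ler_nat.
    move: tL; rewrite in_itv /= => /andP[t1 t2].
    have th : 0 <= t / h by rewrite divr_ge0 ?(ltW h0).
    have := truncn_itv th; set i := Num.truncn _ => /andP[i1 i2].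
    have iN : (i < n.+1)%N.
      rewrite -(ltr_nat R); apply: le_lt_trans i1 _.
      by rewrite ltr_pdivrMr// nh lt_def eq_sym t0.
    exists i => //; rewrite /U iN; exists t => //=.
    by rewrite in_itv /= -ler_pdivlMr// i1 -ler_pdivrMr// ltW.
  move=> i; apply: le_trans (dU i) _; rewrite lee_fin.
  by case: ifP => // _; exact: ltW.
apply: lime_le.
  by apply: is_cvg_nneseries => i _ _; exact: ediam_ge0.
apply: nearW => N.
apply: le_trans (_ : (\sum_(0 <= i < N) (if (i < n.+1)%N then h else 0)%:E <= _)%E).
  by apply: lee_sum => i _.
rewrite sumEFin lee_fin -nh.
suff -> : \sum_(0 <= i < N) (if (i < n.+1)%N then h else 0)
    = (minn N n.+1)%:R * h by rewrite ler_wpM2r ?(ltW h0)// ler_nat geq_minr.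
elim: N => [|N ih]; first by rewrite big_geq// min0n mul0r.
rewrite big_nat_recr//= ih; have [Nn|nN] := boolP (N < n.+1)%N.
  by rewrite (minn_idPl (ltnW Nn)) (minn_idPl Nn) -natr1 mulrDl mul1r.
rewrite -leqNgt in nN; by rewrite addr0 (minn_idPr nN) (minn_idPr (leqW nN)).
Qed.

Lemma curve_competitor r : 0 < r ->
  competitor r (closure (open_nbhd r (g @` `[0%R, L]))) (g @` `[0%R, L]).
Proof.
move=> r0; have [gc _] := gL; split.
- exact: connected_continuous_connected (@segment_connected R 0 L) gc.
- exact: continuous_compact gc (@segment_compact R 0 L).
- apply: ge_ereal_sup => _ [y yM <-]; apply/lee_addgt0Pr => eps eps0.
  have [z [[_ [t tL <-] zt] zy]] := yM _ (open_nbhs_nbhs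
    (conj (@open_eball R d y eps) (@eball_center R d y eps eps0))).
  apply: ge_ereal_inf; exists (enorm (y - g t))%:E.
    by exists (g t) => //; exists t.
  rewrite -EFinD lee_fin; have := enormB z y (g t); move: zt zy.
  by rewrite /eball /= enormC (enormC y z); lra.
Qed.

End SimpleCurve.

Lemma C11_lipschitz {R : realType} {d : nat} (L : R) (g : R -> 'rV[R]_d) :
  C11_on L g -> exists C g', [/\ 0 < C, derivative_on L g g' &
    {in `[0, L] &, forall s t : R, enorm (g' s - g' t) <= C * `|s - t|}].
Proof.
move=> [g' [gD [C gC]]]; have C0 : 0 < `|C| + 1 by rewrite ltr_wpDl.
exists (`|C| + 1), g'; split=> //.
move=> s t sL tL; apply: le_trans (gC s t sL tL) _; rewrite ler_wpM2r//.
by have := ler_norm C; lra.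
Qed.

(** For small radii the parameters of the centres whose ball contains a given
    point form an interval: near-by centres by convexity of the squared
    distance, and far-apart ones because their balls are disjoint. *)
Lemma ball_interval {R : realType} {d : nat} (L : R) (g : R -> 'rV[R]_d) :
  0 < L -> arc_length_param L g -> {in `[0, L] &, injective g} -> C11_on L g ->
  exists2 r0, 0 < r0 & forall r u t w, 0 < r -> r < r0 ->
    0 <= u -> u <= t -> t <= w -> w <= L ->
    eball (g u) r `&` eball (g w) r `<=` eball (g t) r.
Proof.
move=> L0 gL gI /C11_lipschitz[C [g' [C0 gD gC]]].
have d0 : 0 < (4 * C)^-1 by rewrite invr_gt0 mulr_gt0.
have [eta eta0 sep] := curve_separation gL gI d0.
exists (Num.min (eta / 2) (16 * C)^-1).
  by rewrite lt_min divr_gt0//= invr_gt0 mulr_gt0.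
move=> r u t w r0; rewrite lt_min => /andP[r1 r2] u0 ut tw wL z [zu zw].
have uw := le_trans ut tw.
have [near|far] := ltP (w - u) (4 * C)^-1.
  apply: (ball_interval_near gL gD C0 gC) zu zw => //.
    by rewrite mulrC -ler_pdivlMr ?mulr_gt0// mul1r ltW.
  by rewrite mulrC -ler_pdivlMr ?mulr_gt0// mul1r ltW.
have := sep u w; rewrite !in_itv /= u0 wL (le_trans uw wL) (le_trans u0 uw).
rewrite ger0_norm ?subr_ge0// => /(_ isT isT far).
have := enormB z (g w) (g u); move: zu zw; rewrite /eball /= (enormC z (g w)).
by lra.
Qed.

(** * Comparing a curve with a tree *)

Section Cost.
Context {R : realType} {d : nat} (a : R) (m : set 'rV[R]_d -> R).
Hypothesis mP : is_content a m.
Variable e : 'rV[R]_d.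
Hypothesis e1 : enorm e = 1.
Implicit Types (r s : R).
Local Notation F := (ball_content m).
Local Notation psi := (displacement m e).

(** The content swept per unit length by a moving ball of radius [r]. For
    Lebesgue measure this is the volume of the unit ball of R^(d-1) times
    [r ^+ d.-1]. *)
Definition motion_cost r := sup [set psi r s / s | s in [set s | 0 < s]].

Let costP r : 0 < r -> regular_radius m r ->
  has_sup [set psi r s / s | s in [set s | 0 < s]].
Proof.
move=> r0 rr; split; first by exists (psi r 1 / 1); exists 1 => //=; exact: ltr01.
exists (F (r + 2)) => _ [s /= s0 <-]; rewrite ler_pdivrMr//.
exact: (displacement_lin mP e1 r0 rr s0).
Qed.

Lemma displacement_le_cost r s : 0 < r -> regular_radius m r -> 0 <= s ->
  psi r s <= motion_cost r * s.
Proof.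
move=> r0 rr; rewrite le_eqVlt => /predU1P[<-|s0].
  rewrite mulr0 /displacement scale0r setDv.
  have b0 : ebounded (set0 : set 'rV[R]_d) by exists 0.
  by have := content_sep mP b0 b0 ltr01 (fun _ _ (h : False) => match h with end);
    rewrite setU0; lra.
rewrite -ler_pdivrMr//; apply: sup_upper_bound; first exact: costP.
by exists s.
Qed.

Lemma motion_cost_adherent r eps : 0 < r -> regular_radius m r -> 0 < eps ->
  exists2 s, 0 < s & (motion_cost r - eps) * s <= psi r s.
Proof.
move=> r0 rr eps0; have [_ [s /= s0 <-] h] := sup_adherent eps0 (costP r0 rr).
by exists s => //; rewrite -ler_pdivlMr// ltW.
Qed.

Lemma motion_cost_le r : 0 < r -> regular_radius m r ->
  motion_cost r <= F (r + 2).
Proof.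
move=> r0 rr; apply: ge_sup; first by have [] := costP r0 rr.
move=> _ [s /= s0 <-]; rewrite ler_pdivrMr//.
exact: (displacement_lin mP e1 r0 rr s0).
Qed.

Lemma motion_cost_ge r : 0 < r -> regular_radius m r ->
  F r <= motion_cost r * (2 * r).
Proof.
move=> r0 rr; rewrite -(displacement_far mP e1 r0).
by apply: displacement_le_cost; rewrite ?mulr_ge0// ltW.
Qed.

End Cost.

Lemma ler_of_seq {R : realType} (x y z : R) :
  (forall n : nat, x <= y + z / n.+1%:R) -> x <= y.
Proof.
move=> h; rewrite leNgt; apply/negP => yx.
have xy0 : 0 < x - y by rewrite subr_gt0.
have := h (Num.truncn (`|z| / (x - y))).
have := truncn_itv (divr_ge0 (normr_ge0 z) (ltW xy0)).
set n := Num.truncn _ => /andP[_ nz].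
rewrite -lerBlDl ler_pdivlMr// mulrC.
have := ler_norm z; move: nz; rewrite ltr_pdivrMr//; lra.
Qed.

Section Comparison.
Context {R : realType} {d : nat} (a : R) (m : set 'rV[R]_d -> R).
Hypothesis a0 : 0 < a.
Hypothesis mP : is_content a m.
Variable e : 'rV[R]_d.
Hypothesis e1 : enorm e = 1.
Local Notation F := (ball_content m).
Local Notation cost := (motion_cost m e).

(** The content of the tube around a fine chain of points of the curve is at most
    that of the neighbourhood of the tree which contains it. The two sides are
    evaluated by [chain_content] and [tree_content]; by [displacement_fekete]
    the short steps of the chain cost nearly [cost r] per unit length. *)
Lemma tube_comparison (L H r r' : R) (g : R -> 'rV[R]_d) q l :
    0 < L -> a <= r -> regular_radius m r -> 0 < r' -> regular_radius m r' ->
    arc_length_param L g -> C11_on L g ->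
    (forall u t w, 0 <= u -> u <= t -> t <= w -> w <= L ->
      eball (g u) r `&` eball (g w) r `<=` eball (g t) r) ->
    tree q l -> l <= H ->
    (forall t, 0 <= t <= L -> eball (g t) r `<=` \bigcup_(x in [set` q]) eball x r') ->
  F r + cost r * L <= F r' + cost r' * H.
Proof.
move=> L0 ar rr r'0 rr' gL /C11_lipschitz[C [g' [C0 gD gC]]] gint tq lH cov.
have r0 : 0 < r by exact: lt_le_trans ar.
set K := cost r; have K0 : 0 < K.
  have := motion_cost_ge mP e1 r0 rr; have := ball_content_ge1 mP ar.
  move=> F1 /(le_trans F1) /(lt_le_trans ltr01).
  by rewrite pmulr_lgt0// mulr_gt0.
have cost0 : 0 <= cost r'.
  have := motion_cost_ge mP e1 r'0 rr'; have := content_ge0 mP (ebounded_eball 0 r').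
  by move=> F0 /(le_trans F0); rewrite pmulr_lge0// mulr_gt0.
set D := F r' + cost r' * H; suff : K * L <= D - F r by lra.
(* For each [eps] the step [h] of the chain tends to 0, by way of [k]; then
   [eps] does, by way of [n]. *)
apply: (@ler_of_seq _ _ _ (K * L)) => n.
pose eps := K / n.+1%:R; have eps0 : 0 < eps by rewrite divr_gt0.
have epsK : eps <= K by rewrite ler_pdivrMr// ler_peMr ?(ltW K0)// ler1n.
have [s0 s00 s0K] := motion_cost_adherent mP e1 r0 rr eps0.
suff : (K - eps) * s0 * L <= (D - F r) * s0.
  by rewrite mulrAC ler_pM2r// mulrBl /eps (mulrAC K) lerBlDr.
apply: (@ler_of_seq _ _ _ (L * (D - F r) + (K - eps) * s0 * L * (2 * C * L))) => k.
pose h := L / k.+1%:R; have h0 : 0 < h by rewrite divr_gt0.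
have kh : k.+1%:R * h = L by rewrite mulrC divfK.
have ih0 (i : nat) : 0 <= i%:R * h by rewrite mulr_ge0// ltW.
have ihS (i : nat) : i.+1%:R * h - i%:R * h = h.
  by rewrite -natr1 mulrDl mul1r addrAC subrr add0r.
have ihle (i j : nat) : (i <= j)%N -> i%:R * h <= j%:R * h.
  by move=> ij; rewrite ler_wpM2r ?(ltW h0)// ler_nat.
have ihL (i : nat) : (i <= k.+1)%N -> i%:R * h <= L by move=> /ihle; rewrite kh.
pose x (i : nat) := g (i%:R * h).
have tube : F r + \sum_(i < k.+1) displacement m e r (enorm (x i.+1 - x i)) <= D.
  apply: le_trans (chain_content mP e1 (n := k.+1) rr _) _.
    move=> i j /andP[ij jk]; apply: gint => //; rewrite ?ihle ?ihL//.
  apply: le_trans (_ : F r' + cost r' * l <= _); last by rewrite lerD2l ler_wpM2l.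
  have cP t : 0 <= t -> displacement m e r' t <= cost r' * t.
    exact: (displacement_le_cost mP e1 r'0 rr').
  apply: le_trans (tree_content mP e1 cP tq).
  apply: (content_le mP); last exact: ebounded_balls.
  by move=> z [i /= ik]; apply: cov; rewrite ih0 ihL.
pose B := (K - eps) * s0 * (h * (1 - 2 * C * h)).
have step (i : 'I_k.+1) : B <= displacement m e r (enorm (x i.+1 - x i)) * (s0 + h).
  set s := enorm _.
  have hs : h * (1 - 2 * C * h) <= s.
    have := chord_ge gL gD C0 gC (ih0 i) (ihle i i.+1 (leqnSn i)) (ihL _ (ltn_ord i)).
    by rewrite ihS.
  have sh : s <= h.
    by rewrite -[X in _ <= X](ihS i); apply: (chord_le gL) => //; rewrite ?ihle ?ihL.
  have Ks0 : 0 <= (K - eps) * s0 by rewrite mulr_ge0 ?subr_ge0// ltW.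
  apply: le_trans (ler_wpM2l Ks0 hs) _.
  have := enorm_ge0 (x i.+1 - x i); rewrite -/s le_eqVlt => /predU1P[<-|sp].
    by rewrite mulr0 mulr_ge0 ?(displacement_ge0 mP)// addr_ge0 ?ltW.
  apply: le_trans (ler_wpM2r (ltW sp) s0K) _.
  apply: le_trans (displacement_fekete mP e1 r sp s00) _.
  by rewrite ler_wpM2l ?(displacement_ge0 mP)// lerD2l.
have sumB : k.+1%:R * B <= (D - F r) * (s0 + h).
  apply: le_trans (_ : (\sum_(i < k.+1)
    displacement m e r (enorm (x i.+1 - x i))) * (s0 + h) <= _).
    rewrite mulr_suml -[k.+1 in leLHS]card_ord mulr_natl -sumr_const.
    by apply: ler_sum => i _; exact: step.
  by rewrite ler_wpM2r ?addr_ge0 ?(ltW s00) ?(ltW h0)//; lra.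
have kB : k.+1%:R * B = (K - eps) * s0 * L * (1 - 2 * C * h).
  by rewrite /B mulrCA [k.+1%:R * (h * _)]mulrA kh mulrA.
have hk z : L * z / k.+1%:R = h * z by rewrite mulrAC.
have -> : L * (D - F r) + (K - eps) * s0 * L * (2 * C * L)
    = L * (D - F r + (K - eps) * s0 * L * (2 * C)) by ring.
rewrite hk; move: sumB; rewrite kB; lra.
Qed.

End Comparison.

(** * Minimality *)

Section Competitor.
Context {R : realType} {d : nat} (r : R) (gamma S : set 'rV[R]_d).
Hypothesis r0 : 0 < r.
Hypothesis cS : competitor r (closure (open_nbhd r gamma)) S.

(** Covering the neighbourhood of radius [r] of [gamma] forces covering those of
    larger radius [s]: a point of the larger one is within [s - r] of the
    smaller one. *)
Lemma competitor_near s eps c y : r <= s -> 0 < eps -> gamma c -> eball c s y ->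
  exists2 z, S z & enorm (y - z) < s + eps.
Proof.
move=> rs eps0 gc; rewrite /eball /= => yc.
have [_ _ dS] := cS.
have near y' : enorm (y' - c) < r -> exists2 z, S z & enorm (y' - z) < r + eps / 2.
  move=> y'c; have y'M : closure (open_nbhd r gamma) y'.
    by apply: subset_closure; exists c.
  have : (edist_set y' S < (r + eps / 2)%:E)%E.
    apply: le_lt_trans (_ : _ <= r%:E)%E _; last by rewrite lte_fin; lra.
    by apply: le_trans dS; apply: ereal_sup_ubound; exists y'.
  by move=> /ereal_inf_lt[_ [z Sz <-]]; rewrite lte_fin => zr; exists z.
have [yr|yr] := ltP (enorm (y - c)) r.
  by have [z Sz yz] := near y yr; exists z => //; lra.
pose t := enorm (y - c); have t0 : 0 < t by exact: lt_le_trans yr.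
(* [y] is pulled towards [c] until it is just inside the ball of radius [r]. *)
pose k := (r - Num.min (r / 2) (eps / 2)) / t.
have [m0 m1 m2] : [/\ 0 < Num.min (r / 2) (eps / 2), Num.min (r / 2) (eps / 2) <= r / 2
    & Num.min (r / 2) (eps / 2) <= eps / 2].
  by split; rewrite ?lt_min ?ge_min ?lexx ?orbT// !divr_gt0.
have kt : k * t = r - Num.min (r / 2) (eps / 2) by rewrite divfK ?gt_eqF.
have k0 : 0 <= k by rewrite divr_ge0 ?(ltW t0)//; lra.
have k1 : k <= 1 by rewrite ler_pdivrMr// /t; lra.
have [|z Sz yz] := near (c + k *: (y - c)).
  by rewrite addrAC subrr add0r enormZ ger0_norm// -/t kt; lra.
exists z => //.
have := enormB (c + k *: (y - c)) y z.
have -> : y - (c + k *: (y - c)) = (1 - k) *: (y - c).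
  by rewrite scalerBl scale1r opprD addrA.
rewrite enormZ ger0_norm ?subr_ge0// mulrBl mul1r -/t kt.
by move: yc; rewrite -/t; lra.
Qed.

End Competitor.

(** The comparison of volumes, [c_i * L <= c_(i+1) * H] up to a telescoping
    term, over a long increasing sequence of radii, rules out [H < L], since the
    costs [c_i] are bounded and bounded away from 0. *)
Lemma competitor_length {R : realType} {d : nat} (L r0 r : R) (g : R -> 'rV[R]_d)
    (S : set 'rV[R]_d) :
    0 < L -> arc_length_param L g -> {in `[0, L] &, injective g} -> C11_on L g ->
    (forall r u t w, 0 < r -> r < r0 ->
      0 <= u -> u <= t -> t <= w -> w <= L ->
      eball (g u) r `&` eball (g w) r `<=` eball (g t) r) ->
    0 < r -> r < r0 ->
    competitor r (closure (open_nbhd r (g @` `[0%R, L]))) S ->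
  (L%:E <= hausdorff1 S)%E.
Proof.
move=> L0 gL gI gC gint rp rr0 cS; rewrite leNgt; apply/negP => SL.
have [H SH HL] := lte_EFin_between (hausdorff1_ge0 S) SL.
have H0 : 0 < H by rewrite -lte_fin (le_lt_trans (hausdorff1_ge0 S)).
have inL t : 0 <= t <= L -> (g @` `[0%R, L]) (g t).
  by move=> tL; exists t => //=; rewrite in_itv.
have zL : 0 <= (0 : R) <= L by rewrite lexx ltW.
have v0 : 0 < enorm (g L - g 0).
  rewrite lt_def enorm_ge0 andbT; apply/negP => /eqP/enorm_eq0/eqP.
  rewrite subr_eq0 => /eqP /gI; rewrite !in_itv /= !lexx (ltW L0) => /(_ isT isT) L00.
  by move: L0; rewrite L00 ltxx.
pose e := (enorm (g L - g 0))^-1 *: (g L - g 0).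
have e1 : enorm e = 1.
  by rewrite enormZ ger0_norm ?invr_ge0 ?(ltW v0)// mulVf// gt_eqF.
have [m mP] := @exists_content R d r rp.
pose F := ball_content m; pose cost := motion_cost m e.
have [kS nS _] := cS.
have S0 : S !=set0.
  have [z Sz _] := competitor_near rp cS (lexx r) ltr01 (inL 0 zL)
    (eball_center (g 0) rp).
  by exists z.
have step s s' : r <= s -> s < s' -> s' < r0 -> regular_radius m s ->
    regular_radius m s' -> F s + cost s * L <= F s' + cost s' * H.
  move=> rs ss' s'r0 ms ms'.
  pose eta := (s' - s) / 2; have eta0 : 0 < eta by rewrite divr_gt0 ?subr_gt0.
  have [q [l [tq lH Sq]]] := exists_tree nS kS S0 SH eta0.
  have sp : 0 < s by exact: lt_le_trans rs.
  apply: (tube_comparison rp mP e1 L0 rs ms (lt_trans sp ss') ms' gL gC _ tq lH).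
    by move=> u t w; apply: gint => //; exact: lt_trans s'r0.
  move=> t tL y yt; have [z Sz yz] := competitor_near rp cS rs eta0 (inL t tL) yt.
  have [x xq zx] := Sq z Sz; exists x => //.
  have := enormB z y x; move: zx yz; rewrite /eball /= /eta; lra.
(* Increasing radii in [r, r0[, between which the regular ones are chosen. *)
pose b (i : nat) := r0 - (r0 - r) / i.+1%:R.
have b0 i : r <= b i.
  by rewrite /b lerBrDr -lerBrDl ler_pdivrMr// ler_peMr ?ler1n// subr_ge0 ltW.
have b1 i : b i < r0 by rewrite /b gtrBl divr_gt0// subr_gt0.
have bS i : b i < b i.+1.
  by rewrite /b ltrD2l ltrN2 ltr_pM2l ?subr_gt0// ltf_pV2 ?posrE// ltr_nat.
have /choice[rho rhoP] : forall i : nat, exists t,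
    (b i < t < b i.+1) /\ regular_radius m t.
  by move=> i; have [t ? ?] := exists_regular_radius mP (bS i); exists t.
have rho_reg i : regular_radius m (rho i) by have [] := rhoP i.
have rho_ge i : r <= rho i.
  by have [/andP[/ltW h _] _] := rhoP i; exact: le_trans h.
have rho_lt i : rho i < r0.
  by have [/andP[_ /lt_trans h] _] := rhoP i; exact: h.
have rhoS i : rho i < rho i.+1.
  have [/andP[_ h] _] := rhoP i; have [/andP[h' _] _] := rhoP i.+1.
  exact: lt_trans h'.
have rho_gt0 i : 0 < rho i by exact: lt_le_trans (rho_ge i).
have r0p : 0 < r0 by exact: lt_trans rr0.
pose delta := (L - H) / (2 * r0).
have delta0 : 0 < delta by rewrite divr_gt0 ?subr_gt0// mulr_gt0.
have costd i : delta <= (L - H) * cost (rho i).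
  rewrite /delta ler_wpM2l ?subr_ge0 ?(ltW HL)// -[leLHS]mul1r ler_pdivrMr ?mulr_gt0//.
  apply: le_trans (ball_content_ge1 mP (rho_ge i)) _.
  have h := motion_cost_ge mP e1 (rho_gt0 i) (rho_reg i); apply: le_trans h _.
  have c0 : 0 <= cost (rho i).
    have := motion_cost_ge mP e1 (rho_gt0 i) (rho_reg i).
    move=> /(le_trans (ball_content_ge1 mP (rho_ge i))) /(le_trans ler01).
    by rewrite pmulr_lge0// mulr_gt0.
  by rewrite ler_wpM2l// ler_wpM2l// ltW.
have chain k : k%:R * delta <= H * (cost (rho k) - cost (rho 0%N))
    + F (rho k) - F (rho 0%N).
  elim: k => [|k ih]; first by rewrite mul0r !subrr mulr0 add0r subrr.
  have := step _ _ (rho_ge k) (rhoS k) (rho_lt k.+1) (rho_reg k) (rho_reg k.+1).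
  by have := costd k; rewrite -natr1; lra.
pose G := H * F (r0 + 2) + F r0.
have GP k : k%:R * delta <= G.
  apply: le_trans (chain k) _; rewrite /G.
  have c1 : cost (rho k) <= F (r0 + 2).
    apply: le_trans (motion_cost_le mP e1 (rho_gt0 k) (rho_reg k)) _.
    by apply: (ball_content_le mP); rewrite lerD2r ltW.
  have c0 : 0 <= cost (rho 0%N).
    by have := costd 0%N => /(le_trans (ltW delta0)); rewrite pmulr_rge0 ?subr_gt0.
  have F1 : F (rho k) <= F r0 by apply: (ball_content_le mP); exact: ltW.
  have F0 : 0 <= F (rho 0%N) by exact: (content_ge0 mP (ebounded_eball _ _)).
  have := ler_wpM2l (ltW H0) c1; have := mulr_ge0 (ltW H0) c0; lra.
have G0 : 0 <= G by have := GP 0%N; rewrite mul0r.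
have := truncn_itv (divr_ge0 G0 (ltW delta0)) => /andP[_].
by rewrite ltr_pdivrMr// ltNge GP.
Qed.

Theorem corollary2p7 (R : realType) (d : nat) (gamma : set 'rV[R]_d) :
  simple_C11_curve gamma ->
  exists r0 : R, 0 < r0 /\
    forall r : R, 0 < r -> r < r0 ->
      r_minimizer r (closure (open_nbhd r gamma)) gamma.
Proof.
move=> [L [g [L0 gL gI gC ->]]].
have [r0 r00 gint] := ball_interval L0 gL gI gC.
exists r0; split=> // r rp rr0; split; first exact: curve_competitor.
move=> S cS; apply: le_trans (hausdorff1_curve L0 gL) _.
exact: competitor_length gint rp rr0 cS.
Qed.
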